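(* Let $(f_n)_{n\in\mathbb{N}}$ be a sequence in $\mathbb{L}^0_+$ and let $f\in\mathbb{L}^0_+$. Consider the following three statements: (1) Every sequence of forward convex combinations of $(f_n)_{n\in\mathbb{N}}$ converges in $\mathbb{L}^0_+$ to $f$. (2) Whenever a sequence of forward convex combinations of $(f_n)_{n\in\mathbb{N}}$ is convergent in $\mathbb{L}_+$, its limit in $\mathbb{L}_+$ is $f$. (3) There exists $\mathbb{Q}\in\Pi$ such that $\sup_{n\in\mathbb{N}}\mathbb{E}_{\mathbb{Q}}[f_n]<\infty$ and $\lim_{n\to\infty}\mathbb{E}_{\mathbb{Q}}\big[|f_n-f|\big]=0$. (A) Assume that $f_n\to f$ in $\mathbb{L}^0_+$. Then (1), (2) and (3) are equivalent. Moreover: (A1) Under any of the equivalent conditions (1)--(3), $$\overline{\mathrm{conv}}(\{f_1,f_2,\ldots\})=\Big\{\sum_{n\in\mathbb{N}}\alpha_n f_n+\Big(1-\sum_{n\in\mathbb{N}}\alpha_n\Big)f\ \Big|\ (\alpha_n)_{n\in\mathbb{N}}\in\triangle^{\mathbb{N}}\Big\}.$$ Furthermore, with any $\mathbb{Q}\in\Pi$ satisfying condition (3), the set $\overline{\mathrm{conv}}(\{f_1,f_2,\ldots\})$ is $\mathbb{L}^1_+(\mathbb{Q})$-compact, and the $\mathbb{L}^0_+$-topology on $\overline{\mathrm{conv}}(\{f_1,f_2,\ldots\})$ coincides with the $\mathbb{L}^1_+(\mathbb{Q})$-topology. (In particular, $\overline{\mathrm{conv}}(\{f_1,f_2,\ldots\})$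 with the $\mathbb{L}^0_+$-topology is locally convex and compact.) (A2) If any of the equivalent conditions (1)--(3) fails, then the set $\mathcal{C}\subseteq\mathbb{L}_+$ of all possible $\mathbb{L}_+$-limits of sequences of forward convex combinations of $(f_n)_{n\in\mathbb{N}}$ is such that $\{f\}\subsetneq\mathcal{C}$, and $f$ is minimal in $\mathcal{C}$ in the sense that $f\le g$ holds $\Pi$-a.s. for all $g\in\mathcal{C}$. (B) In the special case $f=0$, the equivalence of the three statements (1), (2), (3) and the properties in (A1) and (A2) hold even without the assumption that $f_n\to f$ in $\mathbb{L}^0_+$.
   Context: Let $(\Omega,\mathcal{F},\overline{\mathbb{P}})$ be a probability space and let $\Pi$ be the collection of all probabilities on $(\Omega,\mathcal{F})$ equivalent to $\overline{\mathbb{P}}$ (same null sets). ''$\Pi$-null'' and ''$\Pi$-a.s.'' mean null, respectively a.s., with respect to any (hence all) $\mathbb{P}\in\Pi$. $\mathbb{E}_{\mathbb{P}}$ is expectation under $\mathbb{P}$. $\mathbb{L}_+$ is the set of ($\Pi$-a.s. equivalence classes of) possibly infinite-valued nonnegative random variables, i.e. with values in $[0,\infty]$. For $\mathbb{P}\in\Pi$, $\mathbb{L}_+$ is metrized by $d_{\mathbb{P}}(f,g)=\mathbb{E}_{\mathbb{P}}[|\exp(-f)-\exp(-g)|]$ (with $\exp(-\infty)=0$); the induced topology does not depend on $\mathbb{P}\in\Pi$ ((extended) convergence in probability). $\mathbb{L}^0_+$ is the set of $f\in\mathbb{L}_+$ with $\{f=\infty\}$ $\Pi$-null, with the restriction of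 the $\mathbb{L}_+$-topology (convergence in probability under any $\mathbb{P}\in\Pi$). Convergence in $\mathbb{L}^0_+$ means that both the sequence and its limit belong to $\mathbb{L}^0_+$. For $\mathbb{Q}\in\Pi$, $\mathbb{L}^1_+(\mathbb{Q})$ is the set of nonnegative random variables with finite $\mathbb{Q}$-expectation, with the topology of the norm of $\mathbb{L}^1(\mathbb{Q})$. For $\mathcal{A}\subseteq\mathbb{L}_+$, $\mathrm{conv}(\mathcal{A})$ is the set of all finite convex combinations of elements of $\mathcal{A}$ (with the convention $0\times\infty=0$), and $\overline{\mathrm{conv}}(\mathcal{A})$ is the $\mathbb{L}_+$-closure of $\mathrm{conv}(\mathcal{A})$. A sequence of forward convex combinations of a sequence $(f_n)_{n\in\mathbb{N}}$ in $\mathbb{L}_+$ is any sequence $(h_n)_{n\in\mathbb{N}}$ with $h_n\in\mathrm{conv}(\{f_n,f_{n+1},\ldots\})$ for all $n\in\mathbb{N}$. Here $\mathbb{N}=\{1,2,\ldots\}$. $\triangle^{\mathbb{N}}=\{(\alpha_n)_{n\in\mathbb{N}}\mid \alpha_n\in\mathbb{R}_+\text{ for all }n\in\mathbb{N},\ \sum_{n\in\mathbb{N}}\alpha_n\le 1\}$ is the infinite-dimensional simplex. A convex set with a given topology is called locally convex if each of its points has a neighbourhood base consisting of convex sets.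
   Formalization: In (B), the part {f} ⊊ C of (A2) is false without f_n → f (take f_n = 1, f = 0: then C = {1}); it is replaced by ''C contains an element different from f'', which gives {f} ⊊ C whenever f is in C. Minimality of f is kept. *)

(* Defs.v *)
From HB Require Import structures.
From mathcomp Require Import all_boot all_order all_algebra.
From mathcomp Require Import all_classical all_reals all_analysis.
From mathcomp Require Import measurable_realfun.

Set Implicit Arguments.
Unset Strict Implicit.
Unset Printing Implicit Defensive.

Import Order.TTheory GRing.Theory Num.Theory.
Import numFieldNormedType.Exports.

Local Open Scope classical_set_scope.
Local Open Scope ring_scope.
Local Open Scope ereal_scope.

Section distance_lemmas.
Context d (T : measurableType d) (R : realType).
Implicit Types (mu : {measure set T -> \bar R}) (u v w : T -> \bar R).

Lemma measurable_expeR : measurable_fun [set: \bar R] (@expeR R).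
Proof.
rewrite (_ : expeR = fun x => if x == -oo then 0 else er_map (@expR R) x).
  apply: measurable_fun_ifT => //=.
    by apply: measurable_fun_eqe => //; exact: measurable_cst.
  exact: (@measurable_er_map _ T R _ (@measurable_expR R)).
by apply/funext => -[].
Qed.

Lemma abse_subC (x y : \bar R) : `|x - y| = `|y - x|.
Proof. by move: x y => [x| |] [y| |] //=; rewrite distrC. Qed.

Lemma lee_abse_sub_triangle (y x z : \bar R) :
  `|x - z| <= `|x - y| + `|y - z|.
Proof.
move: x y z => [x| |] [y| |] [z| |] //=; rewrite ?leey//.
by rewrite lee_fin ler_distD.
Qed.

Lemma abse_sub_eq0 (x y : \bar R) : x - y = 0 -> x = y.
Proof.
by move: x y => [x| |] [y| |] //= [] /eqP; rewrite subr_eq0 => /eqP ->.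
Qed.

Lemma measurable_abse_sub u v : measurable_fun setT u ->
  measurable_fun setT v -> measurable_fun setT (fun x => `|u x - v x|).
Proof.
by move=> mu mv; apply: measurableT_comp => //; exact: emeasurable_funB.
Qed.

Lemma integral_abse_sub_eq0 mu u v : measurable_fun setT u ->
  measurable_fun setT v -> \int[mu]_x `|u x - v x| = 0 -> u = v %[ae mu].
Proof.
move=> mu_ mv /(ae_eq_integral_abs mu measurableT (emeasurable_funB mu_ mv)).
by apply: filterS => x /(_ I) /= h _; exact: abse_sub_eq0.
Qed.

Lemma integral_abse_sub_triangle mu v u w : measurable_fun setT u ->
  measurable_fun setT v -> measurable_fun setT w ->
  \int[mu]_x `|u x - w x| <=
    \int[mu]_x `|u x - v x| + \int[mu]_x `|v x - w x|.
Proof.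
move=> mu_ mv mw; rewrite -ge0_integralD//; try exact: measurable_abse_sub.
apply: ge0_le_integral => //; try exact: measurable_abse_sub.
  by apply: emeasurable_funD; exact: measurable_abse_sub.
by move=> x _; exact: lee_abse_sub_triangle.
Qed.

End distance_lemmas.

(* The elements of {mfun_ P, T >-> \bar R} are classes modulo P-a.e. equality,
   coerced to functions by choosing a representative. *)
Record Lplus d (T : measurableType d) (R : realType) (P : probability T R) := {
  Lplus_class :> {mfun_ P, T >-> \bar R} ;
  Lplus_ge0 : \forall w \ae P, 0 <= Lplus_class w }.

Section Lplus_metric.
Context d (T : measurableType d) (R : realType) (P : probability T R).
Implicit Types f g h : Lplus P.

HB.instance Definition _ := gen_eqMixin (Lplus P).
HB.instance Definition _ := gen_choiceMixin (Lplus P).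

Lemma Lplus_measurable f : measurable_fun setT f.
Proof. by rewrite /aqEqMfun_to_fun; exact: measurable_funPT. Qed.

Lemma Lplus_eqP f g : (f : T -> \bar R) = g %[ae P] -> f = g.
Proof.
move: f g => [f f0] [g g0] /= fg.
have fg' : f = g by rewrite -(reprK f) -(reprK g); exact/eqmodP/asboolP.
by subst g; congr Build_Lplus; exact: Prop_irrelevance.
Qed.

Definition Lplus_dist f g : R :=
  fine (\int[P]_w `|expeR (- f w) - expeR (- g w)|).

Let measurable_expN f : measurable_fun setT (fun w => expeR (- f w)).
Proof.
apply: measurableT_comp; first exact: measurable_expeR.
by apply: measurableT_comp => //; exact: Lplus_measurable.
Qed.

Let dist_fin f g :
  \int[P]_w `|expeR (- f w) - expeR (- g w)| \is a fin_num.
Proof.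
rewrite ge0_fin_numE; last exact: integral_ge0.
apply: (@le_lt_trans _ _ (\int[P]_w cst 1 w)).
  apply: ae_ge0_le_integral => //.
  - exact: measurable_abse_sub.
  - move: (Lplus_ge0 f) (Lplus_ge0 g); apply: filterS2 => w f0 g0 _.
    move: (f w) (g w) f0 g0 => [a| |] [b| |] //=; rewrite ?lee_fin => a0 b0.
    + rewrite ler_norml; have := expR_gt0 (- a); have := expR_gt0 (- b).
      have : (expR (- a) <= 1)%R by rewrite expR_le1 oppr_le0.
      have : (expR (- b) <= 1)%R by rewrite expR_le1 oppr_le0.
      move=> ? ? ? ?; apply/andP; split.
        by rewrite lerBrDr (le_trans _ (ltW _ : 0 <= expR (- a))%R)//
           addrC subr_le0.
      by rewrite lerBlDr (le_trans (y := 1%R))// lerDl ltW.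
    + by rewrite subr0 ger0_norm ?expR_ge0// expR_le1 oppr_le0.
    + by rewrite sub0r normrN ger0_norm ?expR_ge0// expR_le1 oppr_le0.
    + by rewrite subrr normr0 ler01.
by rewrite integral_cst//= probability_setT mule1 ltry.
Qed.

Let distxx f : Lplus_dist f f = 0%R.
Proof.
rewrite /Lplus_dist; have := dist_fin f f.
rewrite (ae_eq_integral (cst 0)) ?integral0//.
- by apply: measurable_abse_sub.
- move: (Lplus_ge0 f); apply: filterS => w f0 _ /=.
  by move: (f w) f0 => [a| |] //= _; rewrite subrr normr0.
Qed.

Let dist_eq0 f g : Lplus_dist f g = 0%R -> f = g.
Proof.
move=> d0; have := congr1 (@EFin R) d0; rewrite fineK// => /integral_abse_sub_eq0.
move=> /(_ (measurable_expN f) (measurable_expN g)) fg; apply: Lplus_eqP.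
move: (Lplus_ge0 f) (Lplus_ge0 g) fg; apply: filterS3 => w f0 g0 /(_ I) + _.
move: (f w) (g w) f0 g0 => [a| |] [b| |] //= _ _ [].
- by move=> /expR_inj/oppr_inj ->.
- by move=> /eqP; rewrite expR_eq0.
- by move=> /esym/eqP; rewrite expR_eq0.
Qed.

Let distC f g : Lplus_dist f g = Lplus_dist g f.
Proof.
by rewrite /Lplus_dist; under eq_integral do rewrite abse_subC.
Qed.

Let dist_triangle g f h :
  (Lplus_dist f h <= Lplus_dist f g + Lplus_dist g h)%R.
Proof.
by rewrite -lee_fin EFinD !fineK//; exact: integral_abse_sub_triangle.
Qed.

HB.instance Definition _ :=
  isMetric.Build R (Lplus P) distxx dist_eq0 distC dist_triangle.

End Lplus_metric.

Definition equiv_prob d (T : measurableType d) (R : realType)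
  (P Q : probability T R) := Q `<< P /\ P `<< Q.

Record L1plus d (T : measurableType d) (R : realType) (P Q : probability T R)
    (PQ : equiv_prob P Q) := {
  L1plus_val :> Lplus P ;
  L1plus_fin : \int[Q]_w L1plus_val w < +oo }.

Section L1plus_metric.
Context d (T : measurableType d) (R : realType) (P Q : probability T R).
Context (PQ : equiv_prob P Q).
Implicit Types f g h : L1plus PQ.

HB.instance Definition _ := gen_eqMixin (L1plus PQ).
HB.instance Definition _ := gen_choiceMixin (L1plus PQ).

Definition L1plus_dist f g : R := fine (\int[Q]_w `|f w - g w|).

Let L1_ge0 f : \forall w \ae Q, 0 <= f w.
Proof.
have [N [mN N0 fN]] := Lplus_ge0 f; exists N; split => //.
exact: (null_content_dominatesP Q P).1 PQ.1 N mN N0.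
Qed.

Let L1_integrable f : Q.-integrable setT f.
Proof.
apply/integrableP; split; first exact: Lplus_measurable.
rewrite (le_lt_trans _ (L1plus_fin f))//.
rewrite (ae_eq_integral (fun w => f w))//; try exact: Lplus_measurable.
  by apply: measurableT_comp => //; exact: Lplus_measurable.
by move: (L1_ge0 f); apply: filterS => w f0 _; rewrite gee0_abs.
Qed.

Let mf f : measurable_fun setT f. Proof. exact: Lplus_measurable. Qed.

Let dist_fin f g : \int[Q]_w `|f w - g w| \is a fin_num.
Proof.
rewrite ge0_fin_numE; last exact: integral_ge0.
by have /integrableP[] := integrableB measurableT (L1_integrable f)
  (L1_integrable g).
Qed.

Let distxx f : L1plus_dist f f = 0%R.
Proof.
rewrite /L1plus_dist (ae_eq_integral (cst 0)) ?integral0//.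
- exact: measurable_abse_sub.
- have := integrable_ae measurableT (L1_integrable f).
  by apply: filterS => w /(_ I) fw _; rewrite /= subee ?abse0.
Qed.

Let dist_eq0 f g : L1plus_dist f g = 0%R -> f = g.
Proof.
move=> d0; have := congr1 (@EFin R) d0; rewrite fineK// => /integral_abse_sub_eq0.
move=> /(_ (mf f) (mf g)) /(null_dominates_ae_eq measurableT PQ.2) /Lplus_eqP.
move: f g {d0} => [f f1] [g g1] /= fg; subst g.
by congr Build_L1plus; exact: Prop_irrelevance.
Qed.

Let distC f g : L1plus_dist f g = L1plus_dist g f.
Proof.
by rewrite /L1plus_dist; under eq_integral do rewrite abse_subC.
Qed.

Let dist_triangle g f h :
  (L1plus_dist f h <= L1plus_dist f g + L1plus_dist g h)%R.
Proof.
by rewrite -lee_fin EFinD !fineK//; exact: integral_abse_sub_triangle.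
Qed.

HB.instance Definition _ :=
  isMetric.Build R (L1plus PQ) distxx dist_eq0 distC dist_triangle.

End L1plus_metric.

Section forward_convex.
Context d (T : measurableType d) (R : realType) (P : probability T R).
Implicit Types (f g h : Lplus P) (A K U V : set (Lplus P)).

Definition L0plus : set (Lplus P) := [set f | \forall w \ae P, f w < +oo].

Definition cvg_L0 (h_ : nat -> Lplus P) f :=
  [/\ forall n, L0plus (h_ n), L0plus f & h_ @ \oo --> f].

(* In \bar R, 0 * +oo = 0. *)
Definition cvx_hull A : set (Lplus P) :=
  [set h : Lplus P | exists k (a : 'I_k -> R) (g : 'I_k -> Lplus P),
    [/\ forall i, (0 <= a i)%R, (\sum_i a i)%R = 1%R, forall i, A (g i) &
        (h : T -> \bar R) = (fun w => \sum_i (a i)%:E * g i w) %[ae P]]].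

Definition closed_cvx_hull A : set (Lplus P) := closure (cvx_hull A).

Definition forward_cvx_comb (f_ h_ : nat -> Lplus P) :=
  forall n, cvx_hull [set f_ m | m in [set m | (n <= m)%N]] (h_ n).

Definition forward_cvx_limits (f_ : nat -> Lplus P) : set (Lplus P) :=
  [set g | exists2 h_ : nat -> Lplus P,
    forward_cvx_comb f_ h_ & h_ @ \oo --> g].

Definition simplex : set (nat -> R) :=
  [set a : nat -> R | (forall n, (0 <= a n)%R) /\ \sum_(n <oo) (a n)%:E <= 1].

Definition simplex_comb (f_ : nat -> Lplus P) f : set (Lplus P) :=
  [set g : Lplus P | exists2 a, simplex a &
    (g : T -> \bar R) =
      (fun w => (\sum_(n <oo) (a n)%:E * f_ n w)
                + (1 - \sum_(n <oo) (a n)%:E) * f w) %[ae P]].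

Definition L1_bounded_cvg (Q : probability T R) (f_ : nat -> Lplus P) f :=
  ereal_sup (range (fun n => \int[Q]_w f_ n w)) < +oo /\
  \int[Q]_w `|f_ n w - f w| @[n --> \oo] --> 0.

Definition is_cvx K := forall f g h (t : R), K f -> K g -> (0 <= t <= 1)%R ->
  (h : T -> \bar R) = (fun w => t%:E * f w + (1 - t)%:E * g w) %[ae P] -> K h.

(* For f in K and V `<=` K, V is a neighbourhood of f in the subspace K iff
   within K (nbhs f) V. *)
Definition is_locally_cvx K := is_cvx K /\
  forall f, K f -> forall U, nbhs f U ->
    exists V, [/\ V `<=` K, within K (nbhs f) V, is_cvx V & V `<=` U].

Section L1_topology.
Context (Q : probability T R) (PQ : equiv_prob P Q).

Let incl : L1plus PQ -> Lplus P := @L1plus_val _ _ _ _ _ PQ.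

Definition L1plus_compact K := K `<=` range incl /\ compact (incl @^-1` K).

(* The open sets of both topologies have the same traces on K. *)
Definition L0_L1_topologies_coincide K := forall U,
  (exists2 V : set (Lplus P), open V & U = K `&` V) <->
  (exists2 W : set (L1plus PQ), open W & U = K `&` (incl @` W)).

End L1_topology.

Definition is_lower_bound f A := forall g, A g -> \forall w \ae P, f w <= g w.

Section statements.
Context (f_ : nat -> Lplus P) (f : Lplus P).

Definition forward_cvx_cvg :=
  forall h_ : nat -> Lplus P, forward_cvx_comb f_ h_ -> cvg_L0 h_ f.

Definition forward_cvx_unique_limit :=
  forall (h_ : nat -> Lplus P) g,
    forward_cvx_comb f_ h_ -> h_ @ \oo --> g -> g = f.

Definition L1_cvg_equiv_prob :=
  exists2 Q : probability T R, equiv_prob P Q & L1_bounded_cvg Q f_ f.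

Definition closed_hull_properties :=
  let K := closed_cvx_hull (range f_) in
  [/\ K = simplex_comb f_ f,
      forall (Q : probability T R) (PQ : equiv_prob P Q),
        L1_bounded_cvg Q f_ f ->
        L1plus_compact PQ K /\ L0_L1_topologies_coincide PQ K,
      K `<=` L0plus &
      is_locally_cvx K /\ compact K].

End statements.

End forward_convex.

(* Main.v *)
Require Import Defs.
From HB Require Import structures.
From mathcomp Require Import all_boot all_order all_algebra.
From mathcomp Require Import all_classical all_reals all_analysis.
From mathcomp Require Import measurable_realfun.
From mathcomp Require Import ring lra.

Set Implicit Arguments.
Unset Strict Implicit.
Unset Printing Implicit Defensive.

Import Order.TTheory GRing.Theory Num.Theory.
Import numFieldNormedType.Exports.

(** Why the theorem holds.

    Distances to zero in probability are measured by the gauge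
    [E[1 - exp (- h)]], which is bounded, monotone, subadditive and concave in
    the nonnegative function [h].

    One-sided reduction.  Write [f_n = f + v_n - w_n], where the excess [v_n]
    and the deficit [w_n] are the positive and negative parts of [f_n - f].  The
    deficit is dominated by [f], so once it vanishes in probability, so do all
    its forward convex combinations ([dominated_vanishing_hulls]).  It does
    vanish in both situations of the theorem: in the first because [f_n]
    converges to [f], in the second because [f = 0].  A forward combination of
    the [f_n] is therefore asymptotically [f] plus the same combination of the
    [v_n] ([expN_comb_excess]).  In particular every limit dominates [f]
    ([forward_limit_ge]), and everything depends on whether the forward
    combinations of the [v_n] vanish.

    From unique limits to vanishing.  If these combinations did not vanish, then
    for some [e > 0] those with [E[exp (- h)] <= 1 - e] would form a decreasing
    sequence of nonempty sets stable under midpoints.  In such a sequence of sets, almost minimizers of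
    [E[exp (- h)]] converge almost everywhere, possibly to infinity
    ([convergent_minimizers]); the limit obtained here is nonzero, so
    that [forward_cvx_unique_limit] fails.

    From vanishing to convergence in mean.  If the forward combinations of
    [G_n >= 0] vanish, there are [c_n] tending to infinity such that the convex
    hull of the [c_n G_n] is still bounded in probability ([vanishing_hulls_rescale]).  The
    minimizer [g] of [E[exp (- h)]] over that hull is then finite, and its
    first-order optimality condition reads [E[exp (- g) c_n G_n] <= 2]
    ([minimizer_density]).  Under the measure with density proportional to
    [exp (- g)], the mean of [G_n] is at most of order [1 / c_n].  Applied to
    [G_n = v_n + w_n = |f_n - f|], with an extra factor [exp (- f)] that makes
    [f] integrable, this is [L1_cvg_equiv_prob].  The latter implies
    [forward_cvx_cvg] by averaging distances, and limits in a metric space are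
    unique, which closes the circle.

    The closed convex hull.  Fix [Q] as in [L1_bounded_cvg].  The map sending a
    point [a] of the simplex to [sum a_n f_n + (1 - sum a_n) f] changes in the [L1(Q)] distance
    by at most [sum |a_n - b_n| E_Q |f_n - f|] ([simplex_fun_le]); as the
    coefficients [E_Q |f_n - f|] tend to zero, it is continuous for the product
    topology, for which the simplex is compact.  Its image is thus [L1(Q)]-compact;
    it contains the finite convex combinations and is contained in their closure.
    A continuous injection of a compact set into a Hausdorff space is a
    homeomorphism onto its image, so both topologies agree there, and the
    [L1(Q)] balls provide convex neighbourhoods. *)

Local Open Scope classical_set_scope.
Local Open Scope ring_scope.

(** * Bounded measurable functions and their means *)

Section bounded_measurable.
Context d (T : measurableType d) (R : realType).
Implicit Types (u v : T -> R) (P : probability T R).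

Definition bounded_mfun u :=
  measurable_fun setT u /\ exists M : R, forall w, `|u w| <= M.

Lemma bounded_mfunD u v : bounded_mfun u -> bounded_mfun v ->
  bounded_mfun (fun w => u w + v w).
Proof.
move=> [mu [M uM]] [mv [N vN]]; split; first exact: measurable_funD.
by exists (M + N) => w; rewrite (le_trans (ler_normD _ _)) ?lerD.
Qed.

Lemma bounded_mfunN u : bounded_mfun u -> bounded_mfun (fun w => - u w).
Proof.
move=> [mu [M uM]]; split; first exact: measurableT_comp.
by exists M => w; rewrite normrN.
Qed.

Lemma bounded_mfunB u v : bounded_mfun u -> bounded_mfun v ->
  bounded_mfun (fun w => u w - v w).
Proof. by move=> bu bv; apply: bounded_mfunD => //; exact: bounded_mfunN. Qed.

Lemma bounded_mfunM u v : bounded_mfun u -> bounded_mfun v ->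
  bounded_mfun (fun w => u w * v w).
Proof.
move=> [mu [M uM]] [mv [N vN]]; split; first exact: measurable_funM.
by exists (M * N) => w; rewrite normrM ler_pM.
Qed.

Lemma bounded_mfun_cst c : bounded_mfun (fun=> c).
Proof. by split => //; exists `|c|. Qed.

Lemma bounded_mfunZ c u : bounded_mfun u -> bounded_mfun (fun w => c * u w).
Proof. by move=> ?; apply: bounded_mfunM => //; exact: bounded_mfun_cst. Qed.

Lemma bounded_mfun_norm u : bounded_mfun u -> bounded_mfun (fun w => `|u w|).
Proof.
move=> [mu [M uM]]; split; first exact: measurableT_comp.
by exists M => w; rewrite normr_id.
Qed.

Lemma bounded_mfun_max u v : bounded_mfun u -> bounded_mfun v ->
  bounded_mfun (fun w => Num.max (u w) (v w)).
Proof.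
move=> [mu [M uM]] [mv [N vN]]; split; first exact: measurable_maxr.
exists (Num.max M N) => w; rewrite le_max.
by case: (leP (u w) (v w)) => _; rewrite ?uM ?vN ?orbT.
Qed.

Lemma bounded_mfun01 u : measurable_fun setT u -> (forall w, 0 <= u w <= 1) ->
  bounded_mfun u.
Proof.
move=> mu u01; split=> //; exists 1 => w.
by have /andP[? ?] := u01 w; rewrite ger0_norm.
Qed.

Lemma bounded_mfun_indic (A : set T) : measurable A -> bounded_mfun (\1_A : T -> R).
Proof.
move=> mA; apply: bounded_mfun01; first exact: measurable_indic.
by move=> w; rewrite indicE; case: (w \in A) => /=; lra.
Qed.

Lemma bounded_mfun_sum n (a : nat -> R) (u : nat -> T -> R) :
  (forall m, bounded_mfun (u m)) ->
  bounded_mfun (fun w => \sum_(m < n) a m * u m w).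
Proof.
move=> bu; elim: n => [|n ih].
  under eq_fun do rewrite big_ord0; exact: bounded_mfun_cst.
under eq_fun do rewrite big_ord_recr /=.
by apply: bounded_mfunD => //; exact: bounded_mfunZ.
Qed.

Lemma measurable_expRN u : measurable_fun setT u ->
  measurable_fun setT (fun w => expR (- u w)).
Proof. by move=> mu; apply: measurableT_comp => //; exact: measurableT_comp. Qed.

Lemma expRN01 (x : R) : 0 <= x -> 0 <= expR (- x) <= 1.
Proof. by move=> x0; rewrite expR_ge0 expR_le1 oppr_le0. Qed.

Lemma bounded_mfun_expRN u : measurable_fun setT u -> (forall w, 0 <= u w) ->
  bounded_mfun (fun w => expR (- u w)).
Proof.
by move=> mu u0; apply: bounded_mfun01 => [|w];
  [exact: measurable_expRN|exact: expRN01].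
Qed.

Lemma bounded_mfun_integrable P u : bounded_mfun u ->
  P.-integrable setT (EFin \o u).
Proof.
move=> [mu [M uM]]; apply: measurable_bounded_integrable => //.
  by rewrite [ltLHS](@probability_setT _ _ _ P) ltry.
exists M; split; first by rewrite num_real.
by move=> x Mx w _ /=; rewrite (le_trans (uM w))// ltW.
Qed.

Section expectation.
Variable P : probability T R.

Definition mean u := (\int[P]_w u w)%R.

Let bi := @bounded_mfun_integrable P.

Lemma meanD u v : bounded_mfun u -> bounded_mfun v ->
  mean (fun w => u w + v w) = mean u + mean v.
Proof. by move=> bu bv; rewrite /mean RintegralD//; exact: bi. Qed.

Lemma meanB u v : bounded_mfun u -> bounded_mfun v ->
  mean (fun w => u w - v w) = mean u - mean v.
Proof. by move=> bu bv; rewrite /mean RintegralB//; exact: bi. Qed.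

Lemma meanZ c u : bounded_mfun u -> mean (fun w => c * u w) = c * mean u.
Proof. by move=> bu; rewrite /mean RintegralZl//; exact: bi. Qed.

Lemma mean_le u v : bounded_mfun u -> bounded_mfun v ->
  (forall w, u w <= v w) -> mean u <= mean v.
Proof. by move=> bu bv uv; apply: le_Rintegral => //; exact: bi. Qed.

Lemma mean_cst c : mean (fun=> c) = c.
Proof.
by rewrite /mean Rintegral_cst// [X in fine X](@probability_setT _ _ _ P) mulr1.
Qed.

Lemma mean_ge0 u : (forall w, 0 <= u w) -> 0 <= mean u.
Proof. by move=> u0; apply: Rintegral_ge0. Qed.

Lemma mean_le1 u : measurable_fun setT u -> (forall w, 0 <= u w <= 1) -> mean u <= 1.
Proof.
move=> mu u01; rewrite -[leRHS](mean_cst 1); apply: mean_le.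
- exact: bounded_mfun01.
- exact: bounded_mfun_cst.
- by move=> w; have /andP[] := u01 w.
Qed.

Lemma mean_sum n (a : nat -> R) (u : nat -> T -> R) :
  (forall m, bounded_mfun (u m)) ->
  mean (fun w => \sum_(m < n) a m * u m w) = \sum_(m < n) a m * mean (u m).
Proof.
move=> bu; elim: n => [|n ih].
  by under [in LHS]eq_fun do rewrite big_ord0; rewrite mean_cst big_ord0.
under [in LHS]eq_fun do rewrite big_ord_recr /=.
rewrite meanD ?ih ?meanZ ?big_ord_recr//; first exact: bounded_mfun_sum.
exact: bounded_mfunZ.
Qed.

Lemma EFin_mean u : bounded_mfun u -> (mean u)%:E = (\int[P]_w (u w)%:E)%E.
Proof.
by move=> bu; rewrite /mean /Rintegral fineK//; apply: integrable_fin_num => //; exact: bi.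
Qed.

Lemma ae_eq_mean u v : bounded_mfun u -> bounded_mfun v ->
  (\forall w \ae P, u w = v w) -> mean u = mean v.
Proof.
move=> [mu _] [mv _] uv; rewrite /mean /Rintegral; congr fine.
apply: ae_eq_integral => //; [exact/measurable_EFinP..|].
by apply: filterS uv => w -> _.
Qed.

Lemma ae_mean_le u v : bounded_mfun u -> bounded_mfun v ->
  (\forall w \ae P, u w <= v w) -> mean u <= mean v.
Proof.
move=> bu bv uv; have bm := bounded_mfun_max bu bv.
rewrite -(@ae_eq_mean (fun w => Num.max (u w) (v w)) v)//; last first.
  by apply: filterS uv => w uv; rewrite max_r.
by apply: mean_le => // w; rewrite le_max lexx.
Qed.

Lemma mean_eq0 u : bounded_mfun u -> (forall w, 0 <= u w) -> mean u <= 0 ->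
  \forall w \ae P, u w = 0.
Proof.
move=> bu u0 eu; have {}eu : mean u = 0 by apply/eqP; rewrite eq_le eu mean_ge0.
have := EFin_mean bu; rewrite eu => /esym h.
have : (\int[P]_w `|(u w)%:E| = 0%:E)%E.
  by rewrite -h; apply: eq_integral => w _; rewrite gee0_abs// lee_fin.
have mE : measurable_fun setT (EFin \o u) by apply/measurable_EFinP; case: bu.
move/(ae_eq_integral_abs P measurableT mE).
by apply: filterS => w /(_ I) /= [].
Qed.

Lemma mean_cvg (u_ : nat -> T -> R) u (M : R) :
  (forall n, measurable_fun setT (u_ n)) -> (forall n w, `|u_ n w| <= M) ->
  bounded_mfun u -> (\forall w \ae P, u_ ^~ w @ \oo --> u w) ->
  mean (u_ n) @[n --> \oo] --> mean u.
Proof.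
move=> mu_ uM bu cu.
have bu_ n : bounded_mfun (u_ n) by split => //; exists M.
have [mu _] := bu.
have [|||||_ _] := @dominated_convergence _ T R P setT measurableT
  (fun n => EFin \o u_ n) (EFin \o u) (cst M%:E).
- by move=> n; exact/measurable_EFinP.
- exact/measurable_EFinP.
- by apply: filterS cu => w cw _; apply: cvg_EFin => //; exact: nearW.
- by apply: bi; exact: bounded_mfun_cst.
- by apply: aeW => w n _ /=; rewrite lee_fin.
rewrite -(EFin_mean bu) => /fine_cvgP[_].
by apply: cvg_trans; apply: near_eq_cvg; apply: nearW => n /=.
Qed.

(** Chebyshev and Borel-Cantelli in one step: a series of bounded functions
    whose expectations are dominated by a geometric sequence has an integrable
    sum, hence converges almost everywhere. *)
Lemma ae_is_cvg_series (u_ : nat -> T -> R) C :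
  (forall n, bounded_mfun (u_ n)) -> (forall n w, 0 <= u_ n w) ->
  (forall n, mean (u_ n) <= C * 2^-1 ^+ n) ->
  \forall w \ae P, cvgn (series (u_ ^~ w)).
Proof.
move=> bu u0 uC.
pose S w := (\sum_(n <oo) (u_ n w)%:E)%E.
have mu n : measurable_fun setT (fun w => (u_ n w)%:E).
  by apply/measurable_EFinP; case: (bu n).
have S0 w : (0 <= S w)%E by apply: nneseries_ge0 => n _ _; rewrite lee_fin.
have mS : measurable_fun setT S by apply: ge0_emeasurable_sum => // n w _ _; rewrite lee_fin.
have iS : P.-integrable setT S.
  apply/integrableP; split => //.
  rewrite (eq_integral S); last by move=> w _; rewrite gee0_abs.
  rewrite integral_nneseries//; last by move=> n w _; rewrite lee_fin.
  apply: (@le_lt_trans _ _ (\sum_(n <oo) (C * 2^-1 ^+ n)%:E)%E).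
    apply: lee_nneseries => [n _ _|n _]; first by apply: integral_ge0 => w _; rewrite lee_fin.
    by rewrite -EFin_mean// lee_fin.
  have C0 : 0 <= C by have := uC 0%N; rewrite expr0 mulr1; apply: le_trans; exact: mean_ge0.
  have -> : (\sum_(n <oo) (C * 2^-1 ^+ n)%:E)%E = (limn (series (geometric C 2^-1)))%:E.
    rewrite -EFin_lim; last by apply: is_cvg_geometric_series; rewrite ger0_norm//; lra.
    congr (limn _); apply/funext => n /=.
    by rewrite sumEFin; congr EFin; apply: eq_bigr.
  by rewrite ltry.
have := integrable_ae measurableT iS; apply: filterS => w /(_ I) fS.
apply: nondecreasing_is_cvgn.
  by apply/nondecreasing_seqP => n; rewrite seriesSr/= lerDl.
exists (fine (S w)) => _ [n _ <-] /=.
rewrite -lee_fin fineK// -sumEFin.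
by apply: nneseries_lim_ge => k _ _; rewrite lee_fin.
Qed.

End expectation.
End bounded_measurable.

(** * Comparison of means under a change of weight or of measure *)

Section tightness.
Context d (T : measurableType d) (R : realType).
Implicit Types (F X : T -> R) (P Q : probability T R).

Lemma ae_dominates P Q (A : T -> Prop) : P `<< Q ->
  (\forall w \ae Q, A w) -> \forall w \ae P, A w.
Proof.
move=> PQ [N [mN N0 AN]]; exists N; split => //.
exact: (null_content_dominatesP P Q).1 PQ N mN N0.
Qed.

Lemma cvg_expR (u_ : nat -> R) l : u_ @ \oo --> l ->
  expR (u_ n) @[n --> \oo] --> expR l.
Proof. by move=> ul; apply: (cvg_comp _ _ ul); exact: continuous_expR. Qed.

Lemma onem_expRN01 (x : R) : 0 <= x -> 0 <= 1 - expR (- x) <= 1.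
Proof. by move=> /expRN01 /andP[? ?]; lra. Qed.

(** A finite weight cannot hide mass: outside [F > n], which is small for large
    [n], the factor [exp (- F)] is at least [exp (- n)]; and where [F > n], [X] is
    at most [1 <= 2 (1 - exp (- F / n))].  The bound is uniform in [X]. *)
Lemma mean_le_expRN_weight P F : measurable_fun setT F -> (forall w, 0 <= F w) ->
  forall e : R, 0 < e -> exists2 M : R, 0 < M &
    forall X, measurable_fun setT X -> (forall w, 0 <= X w <= 1) ->
      mean P X <= e + M * mean P (fun w => expR (- F w) * X w).
Proof.
move=> mF F0 e e0.
pose Y n w : R := 1 - expR (- (n%:R^-1 * F w)).
have nF n w : 0 <= n%:R^-1 * F w :> R by rewrite mulr_ge0 ?invr_ge0.
have mnF n : measurable_fun setT (fun w => n%:R^-1 * F w) by exact: measurable_funM.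
have Y01 n w : 0 <= Y n w <= 1 by exact: onem_expRN01.
have bY n : bounded_mfun (Y n).
  apply: bounded_mfunB; first exact: bounded_mfun_cst.
  exact: bounded_mfun_expRN.
have cY : mean P (Y n) @[n --> \oo] --> 0.
  rewrite -[X in _ --> X](mean_cst P 0); apply: (@mean_cvg _ _ _ _ _ _ 1) => //.
  - by move=> n; case: (bY n).
  - by move=> n w; have /andP[? ?] := Y01 n w; rewrite ger0_norm.
  - exact: bounded_mfun_cst.
  apply: aeW => w; rewrite -(subrr 1); apply: cvgB; first exact: cvg_cst.
  rewrite -[X in _ --> X]expR0; apply: cvg_expR; rewrite -oppr0; apply: cvgN.
  rewrite -(mul0r (F w)); apply: cvgMl; apply: (gtr0_cvgV0 _).2.
    by near=> n; rewrite ltr0n; near: n; exact: nbhs_infty_gt.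
  exact: cvgr_idn.
have : \forall n \near \oo, mean P (Y n) < e / 2.
  by apply: (cvgr_lt 0) => //; rewrite divr_gt0.
move=> [N _ /(_ N.+1 (leqnSn _)) /= YN]; exists (expR N.+1%:R); first exact: expR_gt0.
move=> X mX X01; have bX := bounded_mfun01 mX X01.
have bFX : bounded_mfun (fun w => expR (- F w) * X w).
  by apply: bounded_mfunM => //; exact: bounded_mfun_expRN.
apply: (@le_trans _ _ (2 * mean P (Y N.+1) +
    expR N.+1%:R * mean P (fun w => expR (- F w) * X w))); last first.
  by rewrite lerD2r; lra.
rewrite -!meanZ// -meanD; [|exact: bounded_mfunZ..].
apply: mean_le => //; first by apply: bounded_mfunD; exact: bounded_mfunZ.
move=> w; have /andP[X0 X1] := X01 w; have /andP[Yw0 Yw1] := Y01 N.+1 w.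
rewrite mulrA -expRD; have [Fn|Fn] := leP (F w) N.+1%:R.
  have : 1 <= expR (N.+1%:R - F w) by rewrite -[leLHS]expR0 ler_expR subr_ge0.
  by move=> ?; rewrite -[leLHS]add0r lerD ?mulr_ge0// -[leLHS]mul1r ler_wpM2r.
have h : 1 <= 2 * Y N.+1 w.
  have : expR (- (N.+1%:R^-1 * F w)) <= expR (- 1).
    by rewrite ler_expR lerN2 ler_pdivlMl// mulr1 ltW.
  have : expR (- 1) <= 2^-1 :> R.
    by rewrite expRN lef_pV2 ?posrE ?expR_gt0//; apply: expR_ge1Dx.
  rewrite /Y; lra.
have := expR_ge0 (N.+1%:R - F w); set E := expR (_ - _) => E0.
have : 0 <= E * X w by rewrite mulr_ge0.
lra.
Unshelve. all: by end_near. Qed.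

(** Otherwise there would be a sequence [X n] with summable means under [Q] and
    means under [P] bounded below; but it converges to zero almost everywhere
    for [Q], hence for [P], and dominated convergence applies. *)
Lemma mean_abs_continuous P Q : P `<< Q -> forall e : R, 0 < e ->
  exists2 delta : R, 0 < delta &
    forall X, measurable_fun setT X -> (forall w, 0 <= X w <= 1) ->
      mean Q X <= delta -> mean P X <= e.
Proof.
move=> PQ e e0; apply: contrapT => /forall2NP nd.
have /choice[X XP] : forall n : nat, exists X : T -> R,
    [/\ measurable_fun setT X, (forall w, 0 <= X w <= 1),
        mean Q X <= 1 * 2^-1 ^+ n & e < mean P X].
  move=> n; case: (nd (2^-1 ^+ n)) => [[]|]; first by rewrite exprn_gt0// invr_gt0.
  move=> /existsNP[X] /not_implyP[mX] /not_implyP[X01] /not_implyP[QX] /negP.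
  by rewrite -ltNge => PX; exists X; rewrite mul1r.
have bX n : bounded_mfun (X n) by have [? ? _ _] := XP n; exact: bounded_mfun01.
have X0 n w : 0 <= X n w by have [_ /(_ w)/andP[]] := XP n.
have X1 n w : X n w <= 1 by have [_ /(_ w)/andP[]] := XP n.
have := @ae_is_cvg_series _ _ _ Q X 1 bX X0 (fun n => let: And4 _ _ h _ := XP n in h).
move=> /(ae_dominates PQ) cX.
have : mean P (X n) @[n --> \oo] --> 0.
  rewrite -[X in _ --> X](mean_cst P 0); apply: (@mean_cvg _ _ _ _ _ _ 1) => //.
  - by move=> n; case: (bX n).
  - by move=> n w; rewrite ger0_norm.
  - exact: bounded_mfun_cst.
  by apply: filterS cX => w; exact: cvg_series_cvg_0.
move=> /(cvgr_lt 0)/(_ _ e0)[N _ /(_ N (leqnn _))] /=.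
by have [_ _ _] := XP N; lra.
Qed.

End tightness.

(** * Convergence of minimizing sequences *)

Section minimizing.
Context d (T : measurableType d) (R : realType) (P : probability T R).
Implicit Types (g h : T -> R) (D : nat -> set (T -> R)).

Local Notation J h := (mean P (fun w => expR (- h w))).

Lemma expRN_half (x : R) : expR (- x) = expR (- (x / 2)) ^+ 2.
Proof. by rewrite expr2 -expRD; congr expR; lra. Qed.

Lemma expRN_mid (x y : R) :
  expR (- ((x + y) / 2)) = expR (- (x / 2)) * expR (- (y / 2)).
Proof. by rewrite -expRD; congr expR; lra. Qed.

(** The pointwise limit exists only almost everywhere; the truncated upper limit
    is a version of it that is measurable with values in the unit interval
    everywhere. *)
Lemma ae_limit_exists (u_ : nat -> T -> R) :
  (forall n, measurable_fun setT (u_ n)) -> (forall n w, 0 <= u_ n w <= 1) ->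
  (\forall w \ae P, cvgn (u_ ^~ w)) ->
  exists u : T -> R, [/\ measurable_fun setT u, forall w, 0 <= u w <= 1 &
    \forall w \ae P, u_ ^~ w @ \oo --> u w].
Proof.
move=> mu u01 cu.
pose u w := Num.max 0 (Num.min 1 (fine (limn_esup (fun n => (u_ n w)%:E)))).
exists u; split.
- apply: measurable_maxr => //; apply: measurable_minr => //.
  apply: measurableT_comp => //; apply: measurable_fun_limn_esup => n.
  exact/measurable_EFinP.
- by move=> w; rewrite /u le_max lexx /= ge_max ler01 ge_min lexx.
- apply: filterS cu => w cu.
  have l0 : 0 <= lim (u_ ^~ w @ \oo).
    by apply: limr_ge => //; apply: nearW => n; have /andP[] := u01 n w.
  have l1 : lim (u_ ^~ w @ \oo) <= 1.
    by apply: limr_le => //; apply: nearW => n; have /andP[] := u01 n w.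
  have /cvg_limn_einf_sup[_ e] : ((u_ n w)%:E @[n --> \oo] --> (lim (u_ ^~ w @ \oo))%:E)%E.
    by apply: cvg_EFin => //; exact: nearW.
  by rewrite /u e /= (min_idPr l1) (max_idPr l0).
Qed.

(** The parallelogram identity behind the convergence of minimizers: the defect
    of midpoint convexity of [h |-> E[exp (- h)]] is exactly a squared distance. *)
Lemma mean_sqr_expRN_half g h : measurable_fun setT g -> measurable_fun setT h ->
  (forall w, 0 <= g w) -> (forall w, 0 <= h w) ->
  mean P (fun w => (expR (- (g w / 2)) - expR (- (h w / 2))) ^+ 2) =
  J g + J h - 2 * J (fun w => (g w + h w) / 2).
Proof.
move=> mg mh g0 h0.
have bg := bounded_mfun_expRN mg g0; have bh := bounded_mfun_expRN mh h0.
have bm : bounded_mfun (fun w => expR (- ((g w + h w) / 2))).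
  apply: bounded_mfun_expRN => [|w]; last by rewrite divr_ge0 ?addr_ge0.
  by apply: measurable_funM => //; exact: measurable_funD.
rewrite -meanD// -meanZ// -meanB//; [|exact: bounded_mfunD|exact: bounded_mfunZ].
congr mean; apply/funext => w.
by rewrite (expRN_half (g w)) (expRN_half (h w)) expRN_mid; ring.
Qed.

(** Along almost minimizers over shrinking sets, a midpoint cannot do much
    better than its endpoints, so by the parallelogram identity the functions
    [exp (- h_k / 2)] form a fast Cauchy sequence in mean square.  No bound on
    the [h_k] is needed, as their limit [- ln u] may be infinite. *)
Lemma convergent_minimizers D :
  (forall k l, (k <= l)%N -> D l `<=` D k) ->
  (forall k, D k !=set0) ->
  (forall k h, D k h -> measurable_fun setT h /\ forall w, 0 <= h w) ->
  (forall k g h, D k g -> D k h -> D k (fun w => (g w + h w) / 2)) ->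
  exists h_ : nat -> T -> R, exists u : T -> R,
  [/\ forall k, D k (h_ k), measurable_fun setT u, forall w, 0 <= u w <= 1,
      \forall w \ae P, expR (- h_ k w) @[k --> \oo] --> u w &
      forall g, (forall k, D k g) -> mean P u <= J g].
Proof.
move=> Ddec D0 Dm Dmid.
have J1 k h : D k h -> J h <= 1.
  move=> /Dm[? ?]; apply: mean_le1; first exact: measurable_expRN.
  by move=> w; exact: expRN01.
(* [s] is the limit of the increasing sequence of infima over [D m]. *)
pose B := [set x | exists m, forall g, D m g -> x <= J g].
have hB : has_sup B.
  split; first by exists 0; exists 0%N => g _; apply: mean_ge0 => w; exact: expR_ge0.
  exists 1 => x [m xm]; have [g Dg] := D0 m.
  by rewrite (le_trans (xm _ Dg))// (J1 m).
pose s := sup B.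
pose r k : R := 2^-1 ^+ k.
have r0 k : 0 < r k by rewrite exprn_gt0// invr_gt0.
have r1 k : r k <= 1 by rewrite exprn_ile1// ?invr_ge0// invf_le1// ler1n.
have /choice[mh mhP] k : exists mh : nat * (T -> R),
    [/\ (k <= mh.1)%N, D mh.1 mh.2, J mh.2 <= s + r k ^+ 2 &
        forall g, D mh.1 g -> s - r k ^+ 2 <= J g].
  have rk : 0 < r k ^+ 2 by rewrite exprn_gt0// r0.
  have [x [m xm] sx] := sup_adherent rk hB.
  have [h [Dh Jh]] : exists h, D (maxn m k) h /\ J h < s + r k ^+ 2.
    apply: contrapT => /forallNP nh.
    have : s + r k ^+ 2 <= s.
      apply: ub_le_sup; first by case: hB.
      by exists (maxn m k) => g Dg; have /not_andP[//|/negP] := nh g; rewrite -leNgt.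
    lra.
  exists (maxn m k, h); split => //=; [exact: leq_maxr|exact: ltW|].
  move=> g /(Ddec _ _ (leq_maxl m k)) /xm; apply: le_trans; exact: ltW.
pose h_ k := (mh k).2.
have Dh k : D k (h_ k) by have [km ? _ _] := mhP k; exact: (Ddec _ _ km).
have mh_ k : measurable_fun setT (h_ k) by have [] := Dm _ _ (Dh k).
have h0 k w : 0 <= h_ k w by have [_] := Dm _ _ (Dh k).
pose a k w := expR (- (h_ k w / 2)).
have ba k : bounded_mfun (a k).
  apply: bounded_mfun_expRN => [|w]; last by rewrite divr_ge0.
  exact: measurable_funM.
have bda k : bounded_mfun (fun w => `|a k.+1 w - a k w|).
  by apply: bounded_mfun_norm; exact: bounded_mfunB.
have bsa k : bounded_mfun (fun w => (a k.+1 w - a k w) ^+ 2).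
  by under eq_fun do rewrite expr2; apply: bounded_mfunM; exact: bounded_mfunB.
have ea2 k : mean P (fun w => (a k.+1 w - a k w) ^+ 2) <= 4 * r k ^+ 2.
  rewrite mean_sqr_expRN_half//.
  have [_ D1 J1k L1] := mhP k; have [_ D2 J2 L2] := mhP k.+1.
  rewrite -/(h_ k) -/(h_ k.+1) in D1 D2 J1k J2.
  have rS : r k.+1 ^+ 2 <= r k ^+ 2.
    by rewrite [r k.+1]exprS -/(r k); have := sqr_ge0 (r k); lra.
  have Lmid : s - r k ^+ 2 <= J (fun w => (h_ k.+1 w + h_ k w) / 2).
    have [/Ddec km|/ltnW/Ddec mk] := leqP (mh k).1 (mh k.+1).1.
      by apply: L1; apply: Dmid => //; exact: km.
    apply: le_trans (L2 _ _); last by apply: Dmid => //; exact: mk.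
    by rewrite lerB.
  move: J1k J2 Lmid rS; clear.
  by move: (mean _ _) (mean _ _) (mean _ _) (r k ^+ 2) (r k.+1 ^+ 2) => A B' C p q; lra.
(* From mean square to mean, by [2 r y <= r ^+ 2 + y ^+ 2]. *)
have ea k : mean P (fun w => `|a k.+1 w - a k w|) <= 3 * 2^-1 ^+ k.
  have rk := r0 k; rewrite -/(r k).
  have : mean P (fun w => 2 * r k * `|a k.+1 w - a k w|) <=
         mean P (fun w => r k ^+ 2 + (a k.+1 w - a k w) ^+ 2).
    apply: mean_le; [exact: bounded_mfunZ| |].
      by apply: bounded_mfunD => //; exact: bounded_mfun_cst.
    move=> w; rewrite -[X in _ <= _ + X]real_normK ?num_real//.
    rewrite -subr_ge0; have := sqr_ge0 (r k - `|a k.+1 w - a k w|).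
    by rewrite sqrrB mulr_natl; lra.
  rewrite meanZ// meanD//; last exact: bounded_mfun_cst.
  rewrite mean_cst => h; rewrite -(ler_pM2l (_ : 0 < 2 * r k)); last by rewrite mulr_gt0.
  apply: (le_trans h); have := ea2 k; rewrite !expr2.
  have : 0 <= r k * r k by rewrite mulr_ge0 ?ltW.
  lra.
have ca : \forall w \ae P, cvgn (fun k => expR (- h_ k w)).
  have := ae_is_cvg_series bda (fun n w => normr_ge0 _) ea.
  apply: filterS => w cw.
  have ct : cvgn (series (telescope (a ^~ w))) by exact: normed_cvg.
  have ca : cvgn (a ^~ w).
    rewrite (_ : a ^~ w = (fun n => a 0%N w + series (telescope (a ^~ w)) n)).
      by apply: is_cvgD => //; exact: is_cvg_cst.
    by apply/funext => n; rewrite -eq_sum_telescope.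
  under eq_fun do rewrite expRN_half expr2.
  exact: is_cvgM.
have [u [mu u01 cu]] := ae_limit_exists (fun k => measurable_expRN (mh_ k))
  (fun k w => expRN01 (h0 k w)) ca.
exists h_, u; split => // g Dg.
have cJ : J (h_ k) @[k --> \oo] --> mean P u.
  apply: (@mean_cvg _ _ _ _ _ _ 1) => //.
  - by move=> k; exact: measurable_expRN.
  - by move=> k w; rewrite ger0_norm ?expR_ge0//; have /andP[] := expRN01 (h0 k w).
  - exact: bounded_mfun01.
have cr : J g + 2 * r k @[k --> \oo] --> J g + 2 * 0.
  apply: cvgD; first exact: cvg_cst; apply: cvgMr.
  by apply: cvg_expr; rewrite ger0_norm ?invr_ge0// invf_lt1// ltr1n.
rewrite mulr0 addr0 in cr.
apply: (ler_cvg_to cJ cr); apply: nearW => k.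
have [_ _ Jk Lk] := mhP k; have := Lk _ (Dg _); rewrite -/(h_ k) in Jk *.
have : r k ^+ 2 <= r k by rewrite expr2 ler_piMl// ltW.
lra.
Qed.

End minimizing.

(** * Finite convex combinations and hulls of tails *)

Section convex_weights.
Context (R : realType).
Implicit Types (a b x : nat -> R) (n N : nat).

(** Weights are indexed by all natural numbers, with support in [[n, N[], so that
    the same weights can be applied to several sequences and compared. *)
Definition convex_weights n N a :=
  [/\ forall m, 0 <= a m, forall m, ~~ (n <= m < N)%N -> a m = 0 &
      \sum_(m < N) a m = 1].

Lemma sum_widen N N' (x : nat -> R) : (N <= N')%N ->
  (forall m, (N <= m)%N -> x m = 0) -> \sum_(m < N') x m = \sum_(m < N) x m.
Proof.
move=> NN' x0; rewrite -!(big_mkord xpredT x) (big_cat_nat (leq0n N) NN')/=.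
by rewrite [X in _ + X]big1_seq ?addr0// => m; rewrite mem_index_iota => /andP[_ /andP[/x0]].
Qed.

Lemma convex_weights_out n N a m : convex_weights n N a -> (N <= m)%N -> a m = 0.
Proof. by move=> [_ a0 _] Nm; apply: a0; rewrite negb_and -leqNgt Nm orbT. Qed.

Lemma convex_weights_widen n n' N N' a : (n' <= n)%N -> (N <= N')%N ->
  convex_weights n N a -> convex_weights n' N' a.
Proof.
move=> nn' NN' [a0 az a1]; split => //.
  move=> m; rewrite negb_and -ltnNge -leqNgt => /orP[mn|Nm].
    by apply: az; rewrite negb_and -ltnNge (leq_trans mn nn').
  by apply: az; rewrite negb_and -leqNgt orbC (leq_trans NN' Nm).
rewrite (sum_widen NN')// => m Nm.
by apply: az; rewrite negb_and -leqNgt Nm orbT.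
Qed.

Lemma convex_weights_mix n N a b (t : R) : 0 <= t <= 1 ->
  convex_weights n N a -> convex_weights n N b ->
  convex_weights n N (fun m => t * a m + (1 - t) * b m).
Proof.
move=> /andP[t0 t1] [a0 az a1] [b0 bz b1]; split.
- by move=> m; rewrite addr_ge0 ?mulr_ge0 ?subr_ge0.
- by move=> m nm; rewrite az// bz// !mulr0 addr0.
- by rewrite big_split/= -!mulr_sumr a1 b1; ring.
Qed.

Lemma convex_weights_delta n m : (n <= m)%N ->
  convex_weights n m.+1 (fun i => (i == m)%:R).
Proof.
move=> nm; split => //.
- by move=> i; rewrite ltnS; case: eqP => // ->; rewrite nm leqnn.
- rewrite big_ord_recr/= eqxx big1 ?add0r// => i _.
  by rewrite ltn_eqF.
Qed.

Lemma convex_weights_le n N a x c : convex_weights n N a ->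
  (forall m, (n <= m)%N -> x m <= c) -> \sum_(m < N) a m * x m <= c.
Proof.
move=> [a0 az a1] xc; rewrite -[leRHS]mul1r -a1 mulr_suml; apply: ler_sum => m _.
have [nm|mn] := leqP n m; first by rewrite ler_wpM2l// xc.
by rewrite az ?mul0r// negb_and -ltnNge mn.
Qed.

End convex_weights.

Section hull.
Context d (T : measurableType d) (R : realType) (P : probability T R).
Implicit Types (F G : nat -> T -> R) (g h : T -> R).

Definition comb N (a : nat -> R) F : T -> R := fun w => \sum_(m < N) a m * F m w.

Definition hull F n : set (T -> R) :=
  [set h | exists N a, convex_weights n N a /\ h = comb N a F].

Definition nonneg_mfun h := measurable_fun setT h /\ forall w, 0 <= h w.

(** The distance to zero in the topology of convergence in probability. *)
Definition gauge h : R := mean P (fun w => 1 - expR (- h w)).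

(** Uniform form of the convergence to zero of every sequence of forward convex
    combinations. *)
Definition vanishing_hulls F :=
  forall e : R, 0 < e -> exists n, forall h, hull F n h -> gauge h <= e.

Lemma comb_widen n N N' a F : (N <= N')%N -> convex_weights n N a ->
  comb N' a F = comb N a F.
Proof.
move=> NN' aw; apply/funext => w.
rewrite /comb (sum_widen (x := fun m => a m * F m w) NN')// => m Nm.
by rewrite (convex_weights_out aw Nm) mul0r.
Qed.

Lemma comb_cst n N a g : convex_weights n N a -> comb N a (fun=> g) = g.
Proof. by move=> [_ _ a1]; apply/funext => w; rewrite /comb -mulr_suml a1 mul1r. Qed.

Lemma combD N a F G : comb N a (fun m w => F m w + G m w) =
  (fun w => comb N a F w + comb N a G w).
Proof.
apply/funext => w; rewrite /comb -big_split/=.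
by apply: eq_bigr => m _; rewrite mulrDr.
Qed.

Lemma nonneg_mfunD g h : nonneg_mfun g -> nonneg_mfun h ->
  nonneg_mfun (fun w => g w + h w).
Proof.
by move=> [mg g0] [mh h0]; split=> [|w]; [exact: measurable_funD|exact: addr_ge0].
Qed.

Lemma nonneg_mfunZ c h : 0 <= c -> nonneg_mfun h -> nonneg_mfun (fun w => c * h w).
Proof.
by move=> c0 [mh h0]; split=> [|w]; [exact: measurable_funM|exact: mulr_ge0].
Qed.

Lemma nonneg_mfun_sum N F : (forall m, nonneg_mfun (F m)) ->
  nonneg_mfun (fun w => \sum_(m < N) F m w).
Proof.
move=> F0; elim: N => [|N ih].
  by under eq_fun do rewrite big_ord0; split.
by under eq_fun do rewrite big_ord_recr /=; exact: nonneg_mfunD.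
Qed.

Lemma nonneg_mfun_comb N (a : nat -> R) F : (forall m, 0 <= a m) ->
  (forall m, nonneg_mfun (F m)) -> nonneg_mfun (comb N a F).
Proof.
move=> a0 F0.
by apply: (@nonneg_mfun_sum N (fun m w => a m * F m w)) => m; exact: nonneg_mfunZ.
Qed.

Lemma nonneg_mfun_hull F n h : (forall m, nonneg_mfun (F m)) ->
  hull F n h -> nonneg_mfun h.
Proof. by move=> F0 [N [a [[a0 _ _] ->]]]; exact: nonneg_mfun_comb. Qed.

Lemma le_hull F n n' : (n' <= n)%N -> hull F n `<=` hull F n'.
Proof.
move=> nn' h [N [a [aw ->]]]; exists N, a; split => //.
exact: convex_weights_widen aw.
Qed.

Lemma hull_mix F n g h t : 0 <= t <= 1 -> hull F n g -> hull F n h ->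
  hull F n (fun w => t * g w + (1 - t) * h w).
Proof.
move=> t01 [N [a [aw ->]]] [N' [b [bw ->]]].
have aw' := convex_weights_widen (leqnn n) (leq_maxl N N') aw.
have bw' := convex_weights_widen (leqnn n) (leq_maxr N N') bw.
exists (maxn N N'), (fun m => t * a m + (1 - t) * b m); split.
  exact: convex_weights_mix.
rewrite -(comb_widen _ (leq_maxl N N') aw) -(comb_widen _ (leq_maxr N N') bw).
apply/funext => w; rewrite /comb !mulr_sumr -big_split/=.
by apply: eq_bigr => m _; ring.
Qed.

Lemma hull_mid F n g h : hull F n g -> hull F n h ->
  hull F n (fun w => (g w + h w) / 2).
Proof.
move=> Fg Fh; rewrite (_ : (fun w => _) = (fun w => 2^-1 * g w + (1 - 2^-1) * h w)).
  by apply: hull_mix => //; rewrite invr_ge0 invf_le1//; lra.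
by apply/funext => w; lra.
Qed.

Lemma hull_self F n m : (n <= m)%N -> hull F n (F m).
Proof.
move=> nm; exists m.+1, (fun i => (i == m)%:R); split.
  exact: convex_weights_delta.
apply/funext => w; rewrite /comb big_ord_recr/= eqxx mul1r big1 ?add0r// => i _.
by rewrite ltn_eqF// mul0r.
Qed.

Lemma bounded_mfun_onem_expRN h : nonneg_mfun h ->
  bounded_mfun (fun w => 1 - expR (- h w)).
Proof.
move=> [mh h0]; apply: bounded_mfunB; first exact: bounded_mfun_cst.
exact: bounded_mfun_expRN.
Qed.

Lemma gauge_le g h : nonneg_mfun g -> nonneg_mfun h ->
  (forall w, g w <= h w) -> gauge g <= gauge h.
Proof.
move=> g0 h0 gh; apply: mean_le; [exact: bounded_mfun_onem_expRN..|] => w.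
by rewrite lerB// ler_expR lerN2.
Qed.

(** By [(1 - exp (- x)) (1 - exp (- y)) >= 0]. *)
Lemma gaugeD g h : nonneg_mfun g -> nonneg_mfun h ->
  gauge (fun w => g w + h w) <= gauge g + gauge h.
Proof.
move=> g0 h0; rewrite /gauge -meanD; [|exact: bounded_mfun_onem_expRN..].
apply: mean_le.
- by apply: bounded_mfun_onem_expRN; exact: nonneg_mfunD.
- by apply: bounded_mfunD; exact: bounded_mfun_onem_expRN.
move=> w; rewrite opprD expRD.
have /andP[? ?] := onem_expRN01 (g0.2 w).
have /andP[? ?] := onem_expRN01 (h0.2 w).
rewrite -subr_ge0 (_ : _ - _ = (1 - expR (- g w)) * (1 - expR (- h w))); last by ring.
by rewrite mulr_ge0.
Qed.

Lemma gauge_ge0 h : (forall w, 0 <= h w) -> 0 <= gauge h.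
Proof. by move=> h0; apply: mean_ge0 => w; have /andP[] := onem_expRN01 (h0 w). Qed.

Lemma gauge0 : gauge (fun=> 0) = 0.
Proof. by rewrite /gauge oppr0 expR0 subrr mean_cst. Qed.

Lemma gauge_sum N F : (forall m, nonneg_mfun (F m)) ->
  gauge (fun w => \sum_(m < N) F m w) <= \sum_(m < N) gauge (F m).
Proof.
move=> F0; elim: N => [|N ih].
  by under eq_fun do rewrite big_ord0; rewrite gauge0 big_ord0.
under eq_fun do rewrite big_ord_recr /=; rewrite big_ord_recr/=.
apply: (le_trans (gaugeD _ _)) => //; first exact: nonneg_mfun_sum.
by rewrite lerD2r.
Qed.

Lemma vanishing_hullsD F G : (forall m, nonneg_mfun (F m)) ->
  (forall m, nonneg_mfun (G m)) -> vanishing_hulls F -> vanishing_hulls G ->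
  vanishing_hulls (fun m w => F m w + G m w).
Proof.
move=> F0 G0 vF vG e e0; have e20 : 0 < e / 2 by rewrite divr_gt0.
have [n nF] := vF _ e20; have [m mG] := vG _ e20.
exists (maxn n m) => h [N [a [aw ->]]]; rewrite combD.
have [a0 _ _] := aw.
apply: (le_trans (gaugeD _ _)); [exact: nonneg_mfun_comb..|].
rewrite [leRHS]splitr lerD//.
- apply: nF; exists N, a; split => //.
  by apply: convex_weights_widen aw => //; exact: leq_maxl.
- apply: mG; exists N, a; split => //.
  by apply: convex_weights_widen aw => //; exact: leq_maxr.
Qed.

Lemma mul_expRN_le (x : R) : x * expR (- x) <= 1 - expR (- x).
Proof.
have := expR_ge1Dx x; rewrite -subr_ge0 => h.
have : 0 <= (expR x - (1 + x)) * expR (- x) by rewrite mulr_ge0 ?expR_ge0.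
by rewrite mulrBl -expRD subrr expR0 mulrDl mul1r; lra.
Qed.

Lemma onem_expRN_le (x : R) : 1 - expR (- x) <= x.
Proof. by have := expR_ge1Dx (- x); lra. Qed.

(** Below the level of [g], convergence in probability controls means:
    [exp (- g) x <= x exp (- x) <= 1 - exp (- x)] for [x <= g], and the mean of
    [exp (- g) F m] is linear in convex combinations. *)
Lemma dominated_vanishing_hulls F g : (forall m, nonneg_mfun (F m)) ->
  nonneg_mfun g -> (forall m w, F m w <= g w) ->
  gauge (F m) @[m --> \oo] --> 0 -> vanishing_hulls F.
Proof.
move=> F0 [mg g0] Fg cF e e0; have e20 : 0 < e / 2 by rewrite divr_gt0.
have [M M0 tM] := mean_le_expRN_weight P mg g0 e20.
have eM0 : 0 < e / 2 / M by rewrite divr_gt0.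
have [n _ nF] : \forall m \near \oo, gauge (F m) < e / 2 / M by apply: (cvgr_lt 0).
exists n => h [N [a [aw ->]]]; have [a0 _ _] := aw.
have hm := nonneg_mfun_comb N a0 F0; set h' := comb N a F in hm *.
have bh := bounded_mfun_onem_expRN hm.
have bF m := bounded_mfun_onem_expRN (F0 m).
apply: (le_trans (tM _ bh.1 (fun w => onem_expRN01 (hm.2 w)))).
rewrite [leRHS]splitr lerD2l.
rewrite -ler_pdivlMl// mulrC.
have := @convex_weights_le _ n N a (gauge \o F) (e / 2 / M) aw (fun m nm => ltW (nF m nm)).
apply: le_trans.
rewrite /gauge/= -(mean_sum _ _ _ bF); apply: mean_le.
- by apply: bounded_mfunM => //; exact: bounded_mfun_expRN.
- exact: (bounded_mfun_sum _ _ bF).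
move=> w; apply: (@le_trans _ _ (expR (- g w) * h' w)).
  by rewrite ler_wpM2l ?expR_ge0// onem_expRN_le.
rewrite /h' /comb mulr_sumr; apply: ler_sum => m _.
rewrite mulrCA ler_wpM2l//; apply: le_trans (mul_expRN_le _).
by rewrite mulrC ler_wpM2l ?(F0 m).2// ler_expR lerN2.
Qed.

End hull.

(** * Rescaling a sequence with vanishing hulls *)

Section rescaling.
Context d (T : measurableType d) (R : realType) (P : probability T R).
Implicit Types (F G : nat -> T -> R) (g h : T -> R).

Local Notation gauge := (gauge P).

(** Weights of total mass less than one are completed at the index [n], which can
    only increase the combination. *)
Lemma gauge_subhull G n N (b : nat -> R) r : (forall m, nonneg_mfun (G m)) ->
  (forall m, 0 <= b m) -> (forall m, (m < n)%N -> b m = 0) ->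
  \sum_(m < N) b m <= 1 -> (forall h, hull G n h -> gauge h <= r) ->
  gauge (comb N b G) <= r.
Proof.
move=> G0 b0 bn b1 Gr.
pose bt m := if (m < N)%N then b m else 0.
pose a m := bt m + (1 - \sum_(m < N) b m) * (m == n)%:R.
have bt0 m : 0 <= bt m by rewrite /bt; case: ifP.
have a0 m : 0 <= a m by rewrite addr_ge0// mulr_ge0// subr_ge0.
have sbt (x : nat -> R) : \sum_(m < maxn N n.+1) bt m * x m = \sum_(m < N) b m * x m.
  rewrite (sum_widen (x := fun m => bt m * x m) (leq_maxl N n.+1)).
    by apply: eq_bigr => m _; rewrite /bt ltn_ord.
  by move=> m Nm; rewrite /bt ltnNge Nm mul0r.
have aw : convex_weights n (maxn N n.+1) a.
  split=> //.
  - move=> m; rewrite negb_and -ltnNge -leqNgt geq_max => /orP[mn|/andP[Nm nm]].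
      by rewrite /a /bt bn// if_same ltn_eqF// mulr0 addr0.
    by rewrite /a /bt ltnNge Nm gtn_eqF// mulr0 addr0.
  - rewrite big_split/= -mulr_sumr.
    have := sbt (fun=> 1); rewrite -!mulr_suml !mulr1 => ->.
    rewrite (sum_widen (x := fun m => (m == n)%:R) (leq_maxr N n.+1)).
      by have [_ _ ->] := @convex_weights_delta R n n (leqnn n); ring.
    by move=> m nm; rewrite gtn_eqF.
apply: le_trans (Gr (comb (maxn N n.+1) a G) _); last by exists (maxn N n.+1), a.
apply: gauge_le; [exact: nonneg_mfun_comb..|].
move=> w; rewrite /comb -(sbt (G ^~ w)); apply: ler_sum => m _.
by rewrite ler_wpM2r ?(G0 m).2// lerDl mulr_ge0// subr_ge0.
Qed.

Lemma gauge_scale_cvg0 h : nonneg_mfun h ->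
  gauge (fun w => M.+1%:R^-1 * h w) @[M --> \oo] --> 0.
Proof.
move=> [mh h0].
have Mh (M : nat) : nonneg_mfun (fun w => M.+1%:R^-1 * h w).
  by apply: nonneg_mfunZ => //; rewrite invr_ge0.
rewrite -[X in _ --> X](mean_cst P 0); apply: (@mean_cvg _ _ _ _ _ _ 1).
- by move=> M; have [] := bounded_mfun_onem_expRN (Mh M).
- by move=> M w; have /andP[? ?] := onem_expRN01 ((Mh M).2 w); rewrite ger0_norm.
- exact: bounded_mfun_cst.
apply: aeW => w; rewrite -(subrr 1); apply: cvgB; first exact: cvg_cst.
rewrite -[X in _ --> X]expR0; apply: cvg_expR; rewrite -oppr0.
by apply: cvgN; rewrite -(mul0r (h w)); apply: cvgMl; exact: cvg_harmonic.
Qed.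

(** A combination is at most the fixed function [G 0 + ... + G (n - 1)] plus a
    combination of the tail from [n], which is small. *)
Lemma vanishing_hulls_tight G : (forall m, nonneg_mfun (G m)) ->
  vanishing_hulls P G -> forall e : R, 0 < e -> exists M : nat,
  forall h, hull G 0 h -> gauge (fun w => M.+1%:R^-1 * h w) <= e.
Proof.
move=> G0 vG e e0; have e20 : 0 < e / 2 by rewrite divr_gt0.
have [n Gn] := vG _ e20.
have nS := nonneg_mfun_sum n G0.
have [M _ /(_ M (leqnn M)) /= SM] : \forall M \near \oo,
    gauge (fun w => M.+1%:R^-1 * \sum_(m < n) G m w) < e / 2.
  by apply: (cvgr_lt 0) => //; exact: gauge_scale_cvg0.
exists M => _ [N [a [[a0 az a1] ->]]].
pose b m := if (n <= m)%N then a m else 0.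
have b0 m : 0 <= b m by rewrite /b; case: ifP.
have M0 : 0 <= M.+1%:R^-1 :> R by rewrite invr_ge0.
have a_le1 m : a m <= 1.
  have [mN|Nm] := ltnP m N; last by rewrite az// negb_and -leqNgt Nm orbT.
  by rewrite -a1 (bigD1 (Ordinal mN))//= lerDl sumr_ge0.
have nb := nonneg_mfun_comb N b0 G0.
have MS := nonneg_mfunZ M0 nS.
apply: (@le_trans _ _ (gauge (fun w => M.+1%:R^-1 * (\sum_(m < n) G m w) + comb N b G w))).
  apply: gauge_le; first by apply: nonneg_mfunZ => //; exact: nonneg_mfun_comb.
    exact: nonneg_mfunD.
  move=> w.
  apply: (@le_trans _ _ (M.+1%:R^-1 * (\sum_(m < n) G m w) + M.+1%:R^-1 * comb N b G w)).
    rewrite -mulrDr ler_wpM2l//.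
    pose c m := if (m < n)%N then G m w else 0.
    have c0 m : 0 <= c m by rewrite /c; case: ifP => // _; exact: (G0 m).2.
    have -> : \sum_(m < n) G m w = \sum_(m < n) c m.
      by apply: eq_bigr => m _; rewrite /c ltn_ord.
    apply: (@le_trans _ _ (\sum_(m < N) c m + comb N b G w)).
      rewrite -big_split/=; apply: ler_sum => m _.
      rewrite /b /c; case: ltnP => _; last by rewrite add0r.
      by rewrite mul0r addr0 ler_piMl// (G0 m).2.
    rewrite lerD2r -(sum_widen (x := c) (leq_maxl n N)).
      by rewrite -!(big_mkord xpredT) (big_cat_nat (leq0n N) (leq_maxr n N))/= lerDl sumr_ge0.
    by move=> m nm; rewrite /c ltnNge nm.
  by rewrite lerD2l ler_piMl ?nb.2// invf_le1// ler1n.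
apply: (le_trans (gaugeD _ _ _)) => //.
rewrite [leRHS]splitr; apply: lerD; first exact: ltW.
apply: (gauge_subhull (n := n)) => //.
  by move=> m mn; rewrite /b leqNgt mn.
by rewrite -a1; apply: ler_sum => m _; rewrite /b; case: ifP.
Qed.

Lemma sum_exp_half_le N : \sum_(i < N) 2^-1 ^+ i <= 2 :> R.
Proof.
suff -> : \sum_(i < N) 2^-1 ^+ i = 2 - 2 * 2^-1 ^+ N :> R.
  by rewrite gerBl mulr_ge0// exprn_ge0.
elim: N => [|N ih]; first by rewrite big_ord0 expr0; lra.
by rewrite big_ord_recr/= ih exprS; lra.
Qed.

(** With [n j] such that the hull of the tail from [n j] has gauge at most
    [2^- j], take [c m] to be one plus the number of [j < m] with [n j <= m].
    A combination of the [c m * G m] is a sum over [j] of combinations of the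
    tails from [n j]: the first [J] of them are bounded in probability, and the
    others are summable. *)
Lemma vanishing_hulls_rescale G : (forall m, nonneg_mfun (G m)) ->
  vanishing_hulls P G -> exists c : nat -> R,
  [/\ forall m, 1 <= c m,
      forall K : nat, exists n, forall m, (n <= m)%N -> K%:R <= c m &
      forall e : R, 0 < e -> exists M : nat,
        forall h, hull (fun m w => c m * G m w) 0 h ->
          gauge (fun w => M.+1%:R^-1 * h w) <= e].
Proof.
move=> G0 vG.
have /choice[n nG] : forall j : nat, exists n, forall h, hull G n h -> gauge h <= 2^-1 ^+ j.
  by move=> j; apply: vG; rewrite exprn_gt0// invr_gt0.
pose c m : R := 1 + \sum_(j < m) (n j <= m)%N%:R.
exists c; split.
- by move=> m; rewrite lerDl sumr_ge0.
- move=> K; exists (maxn K (\max_(j < K) n j)) => m.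
  rewrite geq_max => /andP[Km nm]; rewrite /c.
  apply: (@le_trans _ _ (\sum_(j < K) 1)); first by rewrite sumr_const card_ord.
  rewrite -[leLHS]add0r lerD//.
  rewrite (_ : \sum_(j < K) 1 = \sum_(j < K) (n j <= m)%N%:R).
    rewrite -!(big_mkord xpredT (fun j => (n j <= m)%N%:R)).
    by rewrite (big_cat_nat (leq0n K) Km)/= lerDl sumr_ge0.
  apply: eq_bigr => j _; rewrite (leq_trans _ nm)//.
  exact: (leq_bigmax j).
move=> e e0.
(* The terms [j >= J] contribute at most [2 * 2^- J <= e / 2]; the [J + 1]
   remaining ones at most [e1] each. *)
have [J Je] : exists J : nat, 2^-1 ^+ J <= e / 4.
  have : (2^-1 : R) ^+ J @[J --> \oo] --> 0.
    by apply: cvg_expr; rewrite ger0_norm ?invr_ge0// invf_lt1// ltr1n.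
  have e40 : 0 < e / 4 by rewrite divr_gt0.
  by move=> /(cvgr_lt 0)/(_ _ e40)[J _ /(_ J (leqnn J))/= /ltW]; exists J.
pose e1 := e / (2 * J.+1%:R).
have e10 : 0 < e1 by rewrite divr_gt0// mulr_gt0.
have [M MG] := vanishing_hulls_tight G0 vG e10.
exists M => _ [N [a [aw ->]]]; have [a0 az a1] := aw.
have M0 : 0 <= M.+1%:R^-1 :> R by rewrite invr_ge0.
have M1 : M.+1%:R^-1 <= 1 :> R by rewrite invf_le1// ler1n.
pose b j m := a m * ((j < m)%N && (n j <= m)%N)%:R.
have b0 j m : 0 <= b j m by rewrite mulr_ge0.
have ba j m : b j m <= a m by rewrite ler_piMr// lern1 leq_b1.
have nt := nonneg_mfun_comb N a0 G0.
have ntj j := nonneg_mfun_comb N (b0 j) G0.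
have combE w : comb N a (fun m w => c m * G m w) w =
    comb N a G w + \sum_(j < N) comb N (b j) G w.
  rewrite /comb exchange_big/= -big_split/=; apply: eq_bigr => m _.
  rewrite mulrA /c mulrDr mulr1 mulrDl -mulr_suml; congr (_ + _ * _).
  rewrite mulr_sumr (sum_widen (x := fun j => b j m) (ltnW (ltn_ord m))).
    by apply: eq_bigr => j _; rewrite /b ltn_ord.
  by move=> j mj; rewrite /b ltnNge mj mulr0.
have eph j : gauge (fun w => M.+1%:R^-1 * comb N (b j) G w) <= if (j < J)%N then e1 else 2^-1 ^+ j.
  have nMj := nonneg_mfunZ M0 (ntj j).
  case: ifPn => jJ.
    apply: (@le_trans _ _ (gauge (fun w => M.+1%:R^-1 * comb N a G w))).
      apply: gauge_le => // [|w]; first exact: nonneg_mfunZ.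
      by rewrite ler_wpM2l// ler_sum// => m _; rewrite ler_wpM2r// (G0 m).2.
    by apply: MG; exists N, a.
  apply: (@le_trans _ _ (gauge (comb N (b j) G))).
    by apply: gauge_le => // w; rewrite ler_piMl// (ntj j).2.
  apply: (gauge_subhull (n := n j)) => //.
    by move=> m mn; rewrite /b (leqNgt (n j)) mn andbF mulr0.
    by rewrite -a1; apply: ler_sum.
  exact: nG.
have -> : (fun w => M.+1%:R^-1 * comb N a (fun m w => c m * G m w) w) =
    (fun w => M.+1%:R^-1 * comb N a G w + \sum_(j < N) M.+1%:R^-1 * comb N (b j) G w).
  by apply/funext => w; rewrite combE mulrDr -mulr_sumr.
apply: (le_trans (gaugeD _ _ _)).
- exact: nonneg_mfunZ.
- apply: (nonneg_mfun_sum N (F := fun j w => M.+1%:R^-1 * comb N (b j) G w)) => j.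
  exact: nonneg_mfunZ.
apply: (@le_trans _ _ (e1 + \sum_(j < N) (if (j < J)%N then e1 else 2^-1 ^+ j))).
  apply: lerD; first by apply: MG; exists N, a.
  apply: (le_trans (@gauge_sum _ _ _ _ _ (fun j w => M.+1%:R^-1 * comb N (b j) G w) _)).
    by move=> j; exact: nonneg_mfunZ.
  by apply: ler_sum => j _; exact: eph.
apply: (@le_trans _ _ (e1 + \sum_(j < J + N) (if (j < J)%N then e1 else 2^-1 ^+ j))).
  rewrite lerD2l -!(big_mkord xpredT (fun j => if (j < J)%N then e1 else 2^-1 ^+ j)).
  rewrite (big_cat_nat (leq0n N) (leq_addl J N))/= lerDl sumr_ge0// => j _.
  by case: ifP => _; [exact: ltW|rewrite exprn_ge0// invr_ge0].
rewrite big_split_ord/=.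
under eq_bigr do rewrite ltn_ord.
under [X in _ + (_ + X)]eq_bigr do rewrite ltnNge leq_addr/= exprD.
rewrite sumr_const card_ord -mulr_sumr.
have e1J : e1 + e1 *+ J = e / 2.
  by rewrite -mulrS -mulr_natr /e1; field; rewrite addrC natr1 pnatr_eq0.
have := sum_exp_half_le N; set S := \sum_(_ < N) _ => S2.
have : 2^-1 ^+ J * S <= 2^-1 ^+ J * 2 by rewrite ler_wpM2l// exprn_ge0// invr_ge0.
rewrite addrA e1J; lra.
Qed.

End rescaling.

(** * A density under which the sequence converges in mean *)

Section density.
Context d (T : measurableType d) (R : realType) (P : probability T R).
Implicit Types (F G : nat -> T -> R) (g h : T -> R).

Local Notation gauge := (gauge P).

(** Boundedness in probability prevents [h_k] from escaping to infinity on a set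
    of positive measure. *)
Lemma tight_limit_gt0 (D : set (T -> R)) (h_ : nat -> T -> R) (u : T -> R) :
  (forall e : R, 0 < e -> exists M : nat,
     forall h, D h -> gauge (fun w => M.+1%:R^-1 * h w) <= e) ->
  (forall h, D h -> nonneg_mfun h) ->
  (forall k, D (h_ k)) -> measurable_fun setT u -> (forall w, 0 <= u w <= 1) ->
  (\forall w \ae P, expR (- h_ k w) @[k --> \oo] --> u w) ->
  \forall w \ae P, 0 < u w.
Proof.
move=> tD Dm Dh mu u01 cu.
pose A := [set w | u w <= 0].
have mA : measurable A.
  have := measurable_fun_ler mu (measurable_cst (0 : R)).
  by move=> /(_ measurableT [set true]); rewrite setTI; exact.
suff : mean P (\1_A : T -> R) <= 0.
  move/mean_eq0 => /(_ (bounded_mfun_indic R mA)) A0.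
  have {}A0 : \forall w \ae P, (\1_A w : R) = 0.
    by apply: A0 => w; rewrite indicE.
  apply: filterS A0 => w; rewrite indicE; have [_|] := boolP (w \in A).
    by move/eqP; rewrite oner_eq0.
  by move=> /negP nA _; rewrite ltNge; apply/negP => uw; apply: nA; rewrite inE.
apply/ler_addgt0Pr => e e0; rewrite add0r.
have [M MD] := tD _ e0.
have M0 : 0 <= M.+1%:R^-1 :> R by rewrite invr_ge0.
have nM k := nonneg_mfunZ M0 (Dm _ (Dh k)).
pose y k w := expR (- (M.+1%:R^-1 * h_ k w)).
have by_ k : bounded_mfun (y k) by exact: bounded_mfun_expRN (nM k).1 (nM k).2.
have c1 : mean P (fun w => \1_A w * (1 - y k w)) @[k --> \oo] --> mean P (\1_A : T -> R).
  apply: (@mean_cvg _ _ _ _ _ _ 1).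
  - move=> k; apply: measurable_funM; first exact: measurable_indic.
    by have [] := bounded_mfun_onem_expRN (nM k).
  - move=> k w; have /andP[? ?] := onem_expRN01 ((nM k).2 w).
    by rewrite indicE; case: (w \in A); rewrite /= ?mul1r ?mul0r ?normr0// ger0_norm.
  - exact: bounded_mfun_indic.
  apply: filterS cu => w cw; rewrite indicE; have [wA|] := boolP (w \in A); last first.
    by move=> _; under eq_fun do rewrite mul0r; exact: cvg_cst.
  rewrite (_ : (fun k => _) = (fun k => 1 - y k w)); last first.
    by apply/funext => k; rewrite mul1r.
  have u0 : u w = 0.
    by move: wA; rewrite inE => uw; apply/eqP; rewrite eq_le uw; have /andP[] := u01 w.
  rewrite -[X in _ --> X](subr0 1); apply: cvgB; first exact: cvg_cst.
  rewrite u0 in cw; apply/cvgrPdist_lt => eps eps0; near=> k.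
  rewrite sub0r normrN ger0_norm ?expR_ge0//.
  rewrite -(@ltr_pXn2r _ M.+1) ?nnegrE ?expR_ge0 ?ltW//.
  rewrite /y -expRM_natl mulrN mulrA mulfV// mul1r.
  by near: k; apply: (cvgr_lt 0) => //; rewrite exprn_gt0.
apply: (cvgr_to_le c1); apply: nearW => k.
apply: (le_trans _ (MD _ (Dh k))); apply: mean_le.
- by apply: bounded_mfunM; [exact: bounded_mfun_indic|exact: bounded_mfun_onem_expRN].
- exact: bounded_mfun_onem_expRN.
move=> w; have /andP[? ?] := onem_expRN01 ((nM k).2 w).
by rewrite indicE; case: (w \in A); rewrite /= ?mul1r ?mul0r.
Unshelve. all: by end_near. Qed.

(** First-order optimality: moving from [g] towards [G] by a fraction [t] cannot
    decrease the mean of [exp (- g)], so the mean of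
    [exp (- (1 - t) g) (1 - exp (- t G))] is at most that of
    [exp (- (1 - t) g) (1 - exp (- t g))], which is at most [2 t] for
    [t <= 1 / 2], as [g exp (- g / 2) <= 2].  Divide by [t] and let it tend to zero.  As [g] need
    not lie in [D], the inequality is first proved along [h_k]. *)
Lemma minimizer_density (D : set (T -> R)) (h_ : nat -> T -> R) g (G : T -> R) :
  (forall h h', D h -> D h' -> forall t, 0 <= t <= 1 ->
     D (fun w => t * h w + (1 - t) * h' w)) ->
  (forall h, D h -> nonneg_mfun h) -> (forall k, D (h_ k)) -> D G ->
  nonneg_mfun g -> (\forall w \ae P, h_ ^~ w @ \oo --> g w) ->
  (forall h, D h -> mean P (fun w => expR (- g w)) <= mean P (fun w => expR (- h w))) ->
  (\int[P]_w (expR (- g w) * G w)%:E <= 2%:E)%E.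
Proof.
move=> Dmix Dm Dh DG [mg g0] cg gmin; have [mG G0] := Dm _ DG.
pose t n : R := n.+2%:R^-1.
have t0 n : 0 < t n by rewrite invr_gt0.
have t2 n : t n <= 2^-1 by rewrite lef_pV2 ?posrE// ler_nat.
have mu : bounded_mfun (fun w => expR (- g w)) by exact: bounded_mfun_expRN.
have nmix n : nonneg_mfun (fun w => (1 - t n) * g w + t n * G w).
  by apply: nonneg_mfunD; apply: nonneg_mfunZ => //; have := t2 n; have := t0 n; lra.
have nmix0 n : nonneg_mfun (fun w => (1 - t n) * g w).
  by apply: nonneg_mfunZ => //; have := t2 n; lra.
have opt n : mean P (fun w => expR (- g w)) <=
    mean P (fun w => expR (- ((1 - t n) * g w + t n * G w))).
  have t1 : 0 <= 1 - t n <= 1 by have := t2 n; have := t0 n; lra.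
  pose hG k w := (1 - t n) * h_ k w + (1 - (1 - t n)) * G w.
  have DhG k : D (hG k) by exact: Dmix.
  have cG : mean P (fun w => expR (- hG k w)) @[k --> \oo] -->
      mean P (fun w => expR (- ((1 - t n) * g w + t n * G w))).
    apply: (@mean_cvg _ _ _ _ _ _ 1).
    - by move=> k; apply: measurable_expRN; exact: (Dm _ (DhG k)).1.
    - move=> k w; rewrite ger0_norm ?expR_ge0//.
      by have /andP[] := expRN01 ((Dm _ (DhG k)).2 w).
    - exact: bounded_mfun_expRN (nmix n).1 (nmix n).2.
    apply: filterS cg => w cw; apply: cvg_expR; apply: cvgN; apply: cvgD.
      exact: cvgMr.
    by rewrite subKr; exact: cvg_cst.
  by apply: (cvgr_to_ge cG); apply: nearW => k; exact: gmin.
have bnd n : (\int[P]_w (expR (- g w) * (G w * expR (- (t n * G w))))%:E <= 2%:E)%E.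
  have ntG : nonneg_mfun (fun w => t n * G w) by apply: nonneg_mfunZ => //; exact: ltW.
  have btG := bounded_mfun_onem_expRN ntG.
  have b1 : bounded_mfun (fun w => expR (- g w) * (t n * (G w * expR (- (t n * G w))))).
    apply: bounded_mfunM => //; split.
      apply: measurable_funM => //; apply: measurable_funM => //.
      exact: measurable_expRN ntG.1.
    exists 1 => w; rewrite mulrA ger0_norm ?mulr_ge0 ?expR_ge0 ?(ltW (t0 _))//.
    by rewrite (le_trans (mul_expRN_le _))// lerBlDr lerDl expR_ge0.
  rewrite (eq_integral (fun w =>
      ((t n)^-1 * (expR (- g w) * (t n * (G w * expR (- (t n * G w))))))%:E)).
    rewrite -EFin_mean; last exact: bounded_mfunZ.
    rewrite meanZ// lee_fin ler_pdivrMl//.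
    have b2 := bounded_mfun_expRN (nmix n).1 (nmix n).2.
    have b3 := bounded_mfun_expRN (nmix0 n).1 (nmix0 n).2.
    have : mean P (fun w => expR (- ((1 - t n) * g w)) - expR (- ((1 - t n) * g w + t n * G w)))
        <= mean P (fun w => expR (- ((1 - t n) * g w)) - expR (- g w)).
      by rewrite meanB// [leRHS]meanB//; apply: lerB (lexx _) (opt n).
    have : mean P (fun w => expR (- ((1 - t n) * g w)) - expR (- g w)) <= mean P (fun=> 2 * t n).
      apply: mean_le; [exact: bounded_mfunB|exact: bounded_mfun_cst|move=> w].
      rewrite (_ : - g w = - ((1 - t n) * g w) + - (t n * g w)); last by ring.
      rewrite expRD -[X in X - _]mulr1 -mulrBr.
      apply: (@le_trans _ _ (expR (- (g w / 2)) * (t n * g w))).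
        apply: ler_pM; rewrite ?expR_ge0// ?onem_expRN_le//.
          by have /andP[] := @onem_expRN01 R (t n * g w) (mulr_ge0 (ltW (t0 n)) (g0 w)).
        rewrite ler_expR lerN2 mulrC ler_wpM2r//; have := t2 n; lra.
      rewrite mulrCA mulrC ler_wpM2r ?(ltW (t0 _))//.
      have := mul_expRN_le (g w / 2); have := expR_ge0 (- (g w / 2)); lra.
    rewrite mean_cst mulrC => h1 h2; apply: (le_trans _ (le_trans h2 h1)).
    apply: mean_le => //; first exact: bounded_mfunB.
    move=> w; apply: (@le_trans _ _ (expR (- g w) * (1 - expR (- (t n * G w))))).
      by rewrite ler_wpM2l ?expR_ge0// mulrA mul_expRN_le.
    rewrite opprD expRD -[X in _ <= X - _]mulr1 -mulrBr ler_wpM2r//.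
      by have /andP[] := onem_expRN01 (ntG.2 w).
    rewrite ler_expR lerN2 -[leRHS]mul1r ler_wpM2r// lerBlDr lerDl; exact: ltW.
  by move=> w _; congr EFin; rewrite [in RHS]mulrCA mulKf// gt_eqF.
pose gn n w := (expR (- g w) * (G w * expR (- (t n * G w))))%:E.
have mgn n : measurable_fun setT (gn n).
  apply/measurable_EFinP; apply: measurable_funM; first exact: measurable_expRN.
  by apply: measurable_funM => //; apply: measurable_expRN; exact: measurable_funM.
have gn0 n w : (0 <= gn n w)%E by rewrite lee_fin !mulr_ge0 ?expR_ge0.
have cgn w : (gn n w @[n --> \oo] --> (expR (- g w) * G w)%:E)%E.
  apply: cvg_EFin; first exact: nearW.
  apply: cvgMr => /=; rewrite -[X in _ --> X]mulr1; apply: cvgMr.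
  rewrite -[X in _ --> X]expR0; apply: cvg_expR; rewrite -oppr0; apply: cvgN.
  rewrite -(mul0r (G w)); apply: cvgMl.
  by have := @cvg_harmonic R; rewrite -cvg_shiftS.
apply: (@le_trans _ _ (limn_einf (fun n => \int[P]_w gn n w))%E).
  have := @fatou _ T R P setT measurableT gn mgn (fun n w _ => gn0 n w).
  by under eq_integral => w _ do rewrite (cvg_limn_einf_sup (cgn w)).1.
rewrite limn_einf_lim; apply: lime_le; first exact: is_cvg_einfs.
apply: nearW => n; apply: (@le_trans _ _ (\int[P]_w gn n w)%E); last exact: bnd.
by apply: ereal_inf_lbound; exists n => //=.
Qed.

(** The optimality bound for the rescaled sequence, [c m] times the mean of
    [u * G m] being at most two. *)
Lemma vanishing_hulls_density G : (forall m, nonneg_mfun (G m)) ->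
  vanishing_hulls P G -> exists u : T -> R,
  [/\ measurable_fun setT u, forall w, 0 < u w <= 1,
      forall m, (\int[P]_w (u w * G m w)%:E <= 2%:E)%E &
      (\int[P]_w (u w * G m w)%:E @[m --> \oo] --> 0)%E].
Proof.
move=> G0 vG; have [c [c1 cy tc]] := vanishing_hulls_rescale G0 vG.
pose H m w := c m * G m w.
have H0 m : nonneg_mfun (H m).
  by apply: nonneg_mfunZ => //; rewrite (le_trans _ (c1 m)).
have Dm h : hull H 0 h -> nonneg_mfun h by exact: nonneg_mfun_hull.
have [||||h_ [u [Dh mu u01 cu umin]]] := @convergent_minimizers _ T R P (fun=> hull H 0).
- by move=> k l _ h.
- by move=> _; exists (H 0%N); exact: hull_self.
- by move=> _ h /Dm.
- by move=> _ g h; exact: hull_mid.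
have u0 := tight_limit_gt0 tc Dm Dh mu u01 cu.
(* [ut] is a version of [u] that is positive everywhere, so that [g] is finite. *)
pose ut w := if 0 < u w then u w else 1.
have ut0 w : 0 < ut w by rewrite /ut; case: ifPn.
have ut1 w : ut w <= 1 by rewrite /ut; case: ifPn => // _; have /andP[] := u01 w.
have mut : measurable_fun setT ut.
  by apply: measurable_fun_if => //; [exact: measurable_fun_ltr|exact: measurable_funTS..].
pose g w := - ln (ut w).
have gE w : expR (- g w) = ut w by rewrite opprK lnK ?posrE.
have g0 w : 0 <= g w by rewrite oppr_ge0 ln_le0.
have mg : measurable_fun setT g by apply: measurableT_comp => //; exact: measurableT_comp.
have utu : \forall w \ae P, ut w = u w by apply: filterS u0 => w uw; rewrite /ut uw.
exists ut.
have Hb m : (\int[P]_w (ut w * H m w)%:E <= 2%:E)%E.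
  under eq_integral do rewrite -gE.
  apply: (@minimizer_density (hull H 0) h_) => //.
  - by move=> h h' Dh1 Dh2 t t01; exact: hull_mix.
  - exact: hull_self.
  - apply: filterS2 utu cu => w uw cw.
    rewrite (_ : h_ ^~ w = fun k => - ln (expR (- h_ k w))); last first.
      by apply/funext => k; rewrite expRK opprK.
    apply: cvgN; apply: (cvg_comp _ _ cw); rewrite -uw.
    by apply: continuous_ln.
  - move=> h Dh1; apply: le_trans (umin h (fun=> Dh1)).
    under [X in mean P X <= _]eq_fun do rewrite gE.
    rewrite (ae_eq_mean _ _ utu)//; [|exact: bounded_mfun01].
    by apply: bounded_mfun01 => // w; rewrite ut1 ltW.
have cG m : ((c m)%:E * \int[P]_w (ut w * G m w)%:E <= 2%:E)%E.
  rewrite -ge0_integralZl_EFin//.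
  - by under eq_integral do rewrite -EFinM mulrCA; exact: Hb.
  - by move=> w _; rewrite lee_fin mulr_ge0 ?(G0 m).2// ltW.
  - by apply/measurable_EFinP; apply: measurable_funM => //; exact: (G0 m).1.
  - by rewrite (le_trans _ (c1 m)).
have iG0 m : (0 <= \int[P]_w (ut w * G m w)%:E)%E.
  by apply: integral_ge0 => w _; rewrite lee_fin mulr_ge0 ?(G0 m).2// ltW.
have bG m : (\int[P]_w (ut w * G m w)%:E <= 2%:E)%E.
  by apply: le_trans (cG m); rewrite -[leLHS]mul1e lee_wpmul2r// lee_fin.
split => //.
- by move=> w; rewrite ut0 ut1.
- have fG m : (\int[P]_w (ut w * G m w)%:E)%E \is a fin_num.
    by rewrite ge0_fin_numE// (le_lt_trans (bG m))// ltry.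
  apply/fine_cvgP; split; first exact: nearW.
  apply/cvgrPdist_le => e e0; have [K Ke] : exists K : nat, 2 / e <= K%:R.
    by exists (Num.bound (2 / e)); rewrite ltW// archi_boundP// divr_ge0// ltW.
  have [n nK] := cy K; exists n => // m /= /nK Kc.
  have f0 : 0 <= fine (\int[P]_w (ut w * G m w)%:E)%E by exact: fine_ge0.
  rewrite sub0r normrN ger0_norm//.
  have := cG m; rewrite -(fineK (fG m)) lee_fin; set x := fine _ in f0 *.
  have : 2 <= c m * e by rewrite -ler_pdivrMr// (le_trans Ke).
  move=> h1 h2; have := le_trans h2 h1; rewrite ler_pM2l//.
  by rewrite (lt_le_trans _ (c1 m)).
Qed.

End density.

(** * Representatives of classes of extended random variables *)

Section Lplus_bridge.
Context d (T : measurableType d) (R : realType) (P : probability T R).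
Implicit Types (f g h : Lplus P) (u : T -> \bar R).

Lemma Lplus_exists u : measurable_fun setT u -> (forall w, (0 <= u w)%E) ->
  exists g : Lplus P, (g : T -> \bar R) = u %[ae P].
Proof.
move=> mu u0.
pose U : {mfun T >-> \bar R} := HB.pack u (isMeasurableFun.Build _ _ _ _ u mu).
pose c : {mfun_ P, T >-> \bar R} := (\pi U)%qT.
have cU : (c : T -> \bar R) = u %[ae P].
  have /eqmodP/asboolP : (repr c = U %[mod {mfun_ P, T >-> \bar R}])%qT by rewrite reprK.
  by [].
have c0 : \forall w \ae P, (0 <= c w)%E.
  by apply: filterS cU => w /(_ I) ->.
by exists (Build_Lplus c0).
Qed.

Lemma Lplus_measurable_max g : measurable_fun setT (fun w => maxe 0%E (g w)).
Proof. by apply: measurable_maxe => //; exact: Lplus_measurable. Qed.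

(** For a class in [L0plus], a version that is finite and nonnegative everywhere. *)
Definition real_rep g : T -> R := fun w => fine (maxe 0%E (g w)).

(** The bounded function [exp (- g)], through which the metric of [Lplus] is an
    [L1] distance. *)
Definition expN g : T -> R := fun w => fine (expeR (- maxe 0%E (g w))).

Lemma nonneg_mfun_real_rep g : nonneg_mfun (real_rep g).
Proof.
split; first by apply: measurableT_comp => //; exact: Lplus_measurable_max.
by move=> w; rewrite fine_ge0// le_max lexx.
Qed.

Lemma real_repE g : L0plus g -> \forall w \ae P, (real_rep g w)%:E = g w.
Proof.
have := Lplus_ge0 g; apply: filterS2 => w g0 gy.
by rewrite /real_rep max_r// fineK// ge0_fin_numE.
Qed.

Lemma expN01 g w : 0 <= expN g w <= 1.
Proof.
rewrite /expN; have : (0 <= maxe 0 (g w))%E by rewrite le_max lexx.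
case: (maxe _ _) => [r| |]//= ; rewrite ?lee_fin ?ler01 ?lexx//.
exact: expRN01.
Qed.

Lemma bounded_mfun_expN g : bounded_mfun (expN g).
Proof.
apply: bounded_mfun01 => [|w]; last exact: expN01.
apply: measurableT_comp => //; apply: measurableT_comp; first exact: measurable_expeR.
by apply: measurableT_comp => //; exact: Lplus_measurable_max.
Qed.

Lemma EFin_expN g : \forall w \ae P, expeR (- g w) = (expN g w)%:E.
Proof.
have := Lplus_ge0 g; apply: filterS => w g0; rewrite /expN max_r//.
by case: (g w) g0.
Qed.

Lemma expN_le f g : (\forall w \ae P, expN f w <= expN g w) ->
  \forall w \ae P, (g w <= f w)%E.
Proof.
have := EFin_expN f; have := EFin_expN g; apply: filterS3 => w gE fE.
rewrite -lee_fin -fE -gE; case: (f w) (g w) => [a| |] [b| |] //=; rewrite ?leey ?leNye//.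
- by rewrite !lee_fin ler_expR lerN2.
- by rewrite lee_fin leNgt expR_gt0.
Qed.

Lemma expN_real g (h : T -> R) : (forall w, 0 <= h w) ->
  (\forall w \ae P, g w = (h w)%:E) -> \forall w \ae P, expN g w = expR (- h w).
Proof.
by move=> h0; apply: filterS => w gh; rewrite /expN gh max_r ?lee_fin.
Qed.

Lemma expN_real_rep g : L0plus g ->
  \forall w \ae P, expN g w = expR (- real_rep g w).
Proof.
move=> g0; apply: expN_real; first exact: (nonneg_mfun_real_rep g).2.
by have := real_repE g0; apply: filterS => w ->.
Qed.

Lemma Lplus_of_expN (u : T -> R) : measurable_fun setT u ->
  (forall w, 0 <= u w <= 1) ->
  exists g : Lplus P, \forall w \ae P, expN g w = u w.
Proof.
move=> mu u01.
pose v w : \bar R := if 0 < u w then (- ln (u w))%:E else +oo%E.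
have [|w|g gv] := @Lplus_exists v.
- apply: measurable_fun_if => //; first exact: measurable_fun_ltr.
  apply: measurable_funTS; apply/measurable_EFinP.
  by apply: measurableT_comp => //; exact: measurableT_comp.
- rewrite /v; case: ifPn => // u0.
  by rewrite lee_fin oppr_ge0 ln_le0//; have /andP[] := u01 w.
exists g; apply: filterS gv => w /(_ I) gv; rewrite /expN gv /v.
case: ifPn => [u0|]; last first.
  rewrite -leNgt => u0; rewrite max_r ?leey//=.
  by apply/eqP; rewrite eq_le u0; have /andP[->] := u01 w.
rewrite max_r/=; last by rewrite lee_fin oppr_ge0 ln_le0//; have /andP[] := u01 w.
by rewrite opprK lnK ?posrE.
Qed.

Lemma Lplus_distE f g : mdist f g = mean P (fun w => `|expN f w - expN g w|).
Proof.
transitivity (Lplus_dist f g); first by [].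
rewrite /Lplus_dist /mean /Rintegral; congr fine; apply: ae_eq_integral => //.
- have mE k : measurable_fun setT (fun w => expeR (- (k : Lplus P) w)).
    apply: measurableT_comp; first exact: measurable_expeR.
    by apply: measurableT_comp => //; exact: Lplus_measurable.
  exact: measurable_abse_sub.
- apply/measurable_EFinP.
  by have [] := bounded_mfun_norm (bounded_mfunB (bounded_mfun_expN f) (bounded_mfun_expN g)).
have := EFin_expN f; have := EFin_expN g; apply: filterS2 => w -> -> _.
by rewrite -EFinB.
Qed.

Lemma Lplus_cvgP (h_ : nat -> Lplus P) g : h_ @ \oo --> g <->
  mean P (fun w => `|expN (h_ n) w - expN g w|) @[n --> \oo] --> 0.
Proof.
have dn n : 0 <= mdist (h_ n) g by exact: mdist_ge0.
split.
- move=> /cvg_ballP hg; apply/cvgrPdist_lt => e e0.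
  have := hg e e0; apply: filterS => n.
  by rewrite ballEmdist /= metric_sym Lplus_distE sub0r normrN ger0_norm// -Lplus_distE.
- move=> /cvgrPdist_lt hg; apply/cvg_ballP => e e0.
  have := hg e e0; apply: filterS => n.
  by rewrite ballEmdist /= metric_sym Lplus_distE sub0r normrN ger0_norm// -Lplus_distE.
Qed.

Lemma Lplus_cvg_unique (h_ : nat -> Lplus P) f g : h_ @ \oo --> f ->
  h_ @ \oo --> g -> f = g.
Proof. by apply: cvg_unique; exact: metric_hausdorff. Qed.

End Lplus_bridge.

(** * Forward convex combinations, excess and deficit *)

Section forward_combinations.
Context d (T : measurableType d) (R : realType) (P : probability T R).
Implicit Types (f g h : Lplus P).

Lemma Lplus_of_real (h : T -> R) : nonneg_mfun h ->
  exists g : Lplus P, \forall w \ae P, g w = (h w)%:E.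
Proof.
move=> [mh h0]; have [||g gh] := @Lplus_exists _ _ _ P (EFin \o h).
- exact/measurable_EFinP.
- by move=> w; rewrite lee_fin.
by exists g; apply: filterS gh => w /(_ I).
Qed.

Lemma ae_real_rep (f_ : nat -> Lplus P) : (forall m, L0plus (f_ m)) ->
  \forall w \ae P, forall m, (real_rep (f_ m) w)%:E = f_ m w.
Proof. by move=> f0; apply/ae_foralln => m; exact: real_repE. Qed.

Lemma sum_delta N p (x : nat -> R) : (p < N)%N ->
  \sum_(j < N) (p == j)%:R * x j = x p.
Proof.
move=> pN; rewrite (bigD1 (Ordinal pN))//= eqxx mul1r big1 ?addr0// => j jp.
by rewrite (_ : _ == _ = false) ?mul0r//; apply: contraNF jp => /eqP pj; apply/eqP/val_inj.
Qed.

(** Families with repetitions are regrouped by index, and conversely an index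
    [i < n] of weight zero is replaced by [n]. *)
Lemma cvx_hullP (f_ : nat -> Lplus P) n h : (forall m, L0plus (f_ m)) ->
  cvx_hull [set f_ m | m in [set m | (n <= m)%N]] h <->
  exists N a, convex_weights n N a /\
    \forall w \ae P, h w = (comb N a (fun m => real_rep (f_ m)) w)%:E.
Proof.
move=> f0; have fE := ae_real_rep f0; split.
- move=> [k [a [g [a0 a1 gf hE]]]].
  have /choice[m mP] : forall i : 'I_k, exists m, (n <= m)%N /\ f_ m = g i.
    by move=> i; have [m /= nm mg] := gf i; exists m.
  pose N := (\max_(i < k) m i).+1.
  have mN i : (m i < N)%N by rewrite ltnS; exact: leq_bigmax.
  pose b j := \sum_(i < k) a i * (m i == j)%:R.
  have bE (x : nat -> R) : \sum_(j < N) b j * x j = \sum_(i < k) a i * x (m i).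
    under eq_bigr do rewrite mulr_suml.
    rewrite exchange_big/=; apply: eq_bigr => i _.
    under eq_bigr do rewrite -mulrA.
    by rewrite -mulr_sumr sum_delta.
  exists N, b; split; first split.
  + by move=> j; apply: sumr_ge0 => i _; rewrite mulr_ge0.
  + move=> j nj; apply: big1 => i _; rewrite (_ : _ == _ = false) ?mulr0//.
    by apply: contraNF nj => /eqP <-; rewrite mN andbT; have [] := mP i.
  + have := bE (fun=> 1); under eq_bigr do rewrite mulr1; move=> ->.
    by under eq_bigr do rewrite mulr1.
  apply: filterS2 fE hE => w fE /(_ I) ->.
  rewrite /comb (bE (fun j => real_rep (f_ j) w)) -sumEFin; apply: eq_bigr => i _.
  by rewrite EFinM fE; have [_ ->] := mP i.
- move=> [N [a [[a0 az a1] hE]]].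
  exists N, (fun i => a i), (fun i => f_ (maxn n i)); split => //.
    by move=> i; exists (maxn n i) => //=; exact: leq_maxl.
  apply: filterS2 fE hE => w fE -> _.
  rewrite /comb -sumEFin; apply: eq_bigr => i _; rewrite EFinM fE.
  have [ni|ni] := leqP n i; first by [].
  by rewrite az ?mul0e// negb_and -ltnNge ni.
Qed.

Lemma forward_cvx_combP (f_ h_ : nat -> Lplus P) : (forall m, L0plus (f_ m)) ->
  forward_cvx_comb f_ h_ <->
  exists (N : nat -> nat) (a : nat -> nat -> R), forall n, convex_weights n (N n) (a n) /\
    \forall w \ae P, h_ n w = (comb (N n) (a n) (fun m => real_rep (f_ m)) w)%:E.
Proof.
move=> f0; split.
- move=> fh.
  have /choice[Na NaP] : forall n, exists Na : nat * (nat -> R), convex_weights n Na.1 Na.2 /\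
    \forall w \ae P, h_ n w = (comb Na.1 Na.2 (fun m => real_rep (f_ m)) w)%:E.
    by move=> n; have /(cvx_hullP n (h_ n) f0)[N [a Na]] := fh n; exists (N, a).
  by exists (fun n => (Na n).1), (fun n => (Na n).2).
- by move=> [N [a Na]] n; apply/cvx_hullP => //; exists (N n), (a n).
Qed.

Lemma forward_cvx_comb_self (f_ : nat -> Lplus P) : (forall m, L0plus (f_ m)) ->
  forward_cvx_comb f_ f_.
Proof.
move=> f0 n; apply/cvx_hullP => //.
have [N [a [aw e]]] := hull_self (fun m => real_rep (f_ m)) (leqnn n).
by exists N, a; split => //; rewrite -e; have := real_repE (f0 n); apply: filterS => w ->.
Qed.

Lemma forward_cvx_comb_L0 (f_ h_ : nat -> Lplus P) : (forall m, L0plus (f_ m)) ->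
  forward_cvx_comb f_ h_ -> forall n, L0plus (h_ n).
Proof.
move=> f0 /(forward_cvx_combP _ f0)[N [a Na]] n; have [_] := Na n.
by apply: filterS => w ->; rewrite ltry.
Qed.

End forward_combinations.

Section one_sided.
Context d (T : measurableType d) (R : realType) (P : probability T R).
Context (f_ : nat -> Lplus P) (f : Lplus P).
Hypotheses (f0_ : forall m, L0plus (f_ m)) (f0 : L0plus f).

Local Notation F := (fun m => real_rep (f_ m)).
Local Notation F0 := (real_rep f).

Definition excess m (w : T) : R := Num.max 0 (F m w - F0 w).

Definition deficit m (w : T) : R := Num.max 0 (F0 w - F m w).

Lemma nonneg_mfun_excess m : nonneg_mfun (excess m).
Proof.
split=> [|w]; last by rewrite /excess le_max lexx.
apply: measurable_maxr => //; apply: measurable_funB; exact: (nonneg_mfun_real_rep _).1.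
Qed.

Lemma nonneg_mfun_deficit m : nonneg_mfun (deficit m).
Proof.
split=> [|w]; last by rewrite /deficit le_max lexx.
apply: measurable_maxr => //; apply: measurable_funB; exact: (nonneg_mfun_real_rep _).1.
Qed.

Lemma deficit_le m w : deficit m w <= F0 w.
Proof.
rewrite /deficit ge_max (nonneg_mfun_real_rep f).2/= gerBl.
exact: (nonneg_mfun_real_rep _).2.
Qed.

Lemma excess_deficit m w : F m w + deficit m w = F0 w + excess m w.
Proof.
by rewrite /excess /deficit; case: (leP 0 (F m w - F0 w)) => ?;
  case: (leP 0 (F0 w - F m w)) => ?; lra.
Qed.

Lemma excess_deficit_norm m w : excess m w + deficit m w = `|F m w - F0 w|.
Proof.
rewrite /excess /deficit -(opprB (F m w)).
by case: (leP 0 (F m w - F0 w)) => h; [rewrite ger0_norm// max_l|rewrite ltr0_norm// max_r]; lra.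
Qed.

Lemma comb_excess_deficit n N a w : convex_weights n N a ->
  comb N a F w + comb N a deficit w = F0 w + comb N a excess w.
Proof.
move=> aw; rewrite -[F0 in RHS](comb_cst F0 aw) /comb -!big_split/=.
by apply: eq_bigr => m _; rewrite -!mulrDr excess_deficit.
Qed.

Hypothesis deficit0 : gauge P (deficit m) @[m --> \oo] --> 0.

Lemma vanishing_deficit : vanishing_hulls P deficit.
Proof.
apply: (@dominated_vanishing_hulls _ _ _ _ _ F0) deficit0.
- exact: nonneg_mfun_deficit.
- exact: nonneg_mfun_real_rep.
- exact: deficit_le.
Qed.

Lemma gauge_comb_deficit_cvg0 (N : nat -> nat) (a : nat -> nat -> R) :
  (forall n, convex_weights n (N n) (a n)) ->
  gauge P (comb (N n) (a n) deficit) @[n --> \oo] --> 0.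
Proof.
move=> aw; apply/cvgrPdist_le => e e0; have [n nd] := vanishing_deficit e0.
exists n => // k /= nk; rewrite sub0r normrN ger0_norm; last first.
  apply: gauge_ge0 => w; have [a0 _ _] := aw k.
  exact: (nonneg_mfun_comb _ a0 nonneg_mfun_deficit).2.
apply: nd; exists (N k), (a k); split => //; exact: convex_weights_widen (aw k).
Qed.

(** Only the excess matters for limits: the deficit of a forward convex
    combination is asymptotically negligible. *)
Lemma expN_comb_excess n N a (h : Lplus P) : convex_weights n N a ->
  (\forall w \ae P, h w = (comb N a F w)%:E) ->
  \forall w \ae P, `|expN h w - expN f w * expR (- comb N a excess w)| <=
    1 - expR (- comb N a deficit w).
Proof.
move=> aw hE; have [a0 _ _] := aw.
have hF := expN_real (nonneg_mfun_comb N a0 (fun m => nonneg_mfun_real_rep (f_ m))).2 hE.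
apply: filterS2 hF (expN_real_rep f0) => w -> ->.
rewrite -expRD -opprD -(comb_excess_deficit w aw) opprD expRD -[X in X - _]mulr1 -mulrBr.
have C0 := (nonneg_mfun_comb N a0 nonneg_mfun_deficit).2 w.
have G0 := (nonneg_mfun_comb N a0 (fun m => nonneg_mfun_real_rep (f_ m))).2 w.
have /andP[? ?] := onem_expRN01 C0; have /andP[? ?] := expRN01 G0.
by rewrite ger0_norm ?mulr_ge0// ler_piMl.
Qed.

(** Up to the negligible deficit, a combination of the [f_ m] is at least [f]; the
    positive part of [exp (- g) - exp (- f)] is thus bounded in mean by terms
    that tend to zero. *)
Lemma forward_limit_ge : is_lower_bound f (forward_cvx_limits f_).
Proof.
move=> g [h_ /(forward_cvx_combP _ f0_)[N [a Na]] /Lplus_cvgP hg].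
have aw n : convex_weights n (N n) (a n) by have [] := Na n.
apply: expN_le.
have bg := bounded_mfun_expN g; have bf := bounded_mfun_expN f.
pose x w := Num.max 0 (expN g w - expN f w).
have bx : bounded_mfun x.
  by apply: bounded_mfun_max; [exact: bounded_mfun_cst|exact: bounded_mfunB].
suff : mean P x <= 0.
  move=> /(mean_eq0 bx); have x0 w : 0 <= x w by rewrite /x le_max lexx.
  move=> /(_ x0); apply: filterS => w xw.
  by rewrite -subr_le0 -xw /x le_max lexx orbT.
have hl : mean P (fun w => `|expN (h_ n) w - expN g w|) +
    gauge P (comb (N n) (a n) deficit) @[n --> \oo] --> 0.
  by rewrite -[X in _ --> X]addr0; exact: (cvgD hg (gauge_comb_deficit_cvg0 aw)).
apply: (cvgr_to_ge hl); apply: nearW => n.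
have [a0 _ _] := aw n.
have bd := bounded_mfun_onem_expRN (nonneg_mfun_comb (N n) a0 nonneg_mfun_deficit).
have bh := bounded_mfun_norm (bounded_mfunB (bounded_mfun_expN (h_ n)) bg).
rewrite /gauge -meanD//.
have [_ /(expN_comb_excess (aw n)) hE] := Na n.
apply: ae_mean_le => //; first exact: bounded_mfunD.
apply: filterS hE => w hE.
have E0 := (nonneg_mfun_comb (N n) a0 nonneg_mfun_excess).2 w.
have /andP[E1 E2] := expRN01 E0.
have C0 := (nonneg_mfun_comb (N n) a0 nonneg_mfun_deficit).2 w.
have /andP[C1 _] := onem_expRN01 C0.
have /andP[ef0 _] := expN01 f w.
move: (ler_piMr ef0 E2) hE C1; rewrite ler_norml => + /andP[_ +].
have := ler_norm (- (expN (h_ n) w - expN g w)).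
have := normr_ge0 (expN (h_ n) w - expN g w); rewrite normrN /x ge_max.
move: `|expN (h_ n) w - expN g w| (expR (- comb _ _ deficit w)).
move: (expN f w * expR (- comb _ _ excess w)).
move: (expN (h_ n) w) (expN g w) (expN f w); clear => *.
by apply/andP; split; lra.
Qed.

End one_sided.

(** * Probability measures given by a density *)

Section density_measure.
Context d (T : measurableType d) (R : realType) (P : probability T R).
Variable rho : T -> R.

(** The hypotheses are arguments so that the measure and probability structures,
    which depend on them, can be inferred. *)
Definition density_measure (mrho : measurable_fun setT rho)
  (rho_gt0 : forall w, 0 < rho w) (int_rho : (\int[P]_w (rho w)%:E = 1)%E)
  (A : set T) : \bar R := (\int[P]_(w in A) (rho w)%:E)%E.

Hypotheses (mrho : measurable_fun setT rho) (rho_gt0 : forall w, 0 < rho w).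
Hypothesis int_rho : (\int[P]_w (rho w)%:E = 1)%E.

Local Notation Q := (density_measure mrho rho_gt0 int_rho).

Let rho0 w : (0 <= (rho w)%:E)%E. Proof. by rewrite lee_fin ltW. Qed.

Let mE A : measurable_fun A (fun w => (rho w)%:E).
Proof. by apply: measurable_funTS; exact/measurable_EFinP. Qed.

Let density_measure0 : Q set0 = 0%E.
Proof. by rewrite /density_measure integral_set0. Qed.

Let density_measure_ge0 A : (0 <= Q A)%E.
Proof. by apply: integral_ge0 => w _; exact: rho0. Qed.

Let density_measure_sigma_additive : semi_sigma_additive Q.
Proof.
move=> /= A mA tA mUA; rewrite /density_measure; apply: cvg_toP.
  apply: ereal_nondecreasing_is_cvgn => m n mn.
  apply: lee_sum_nneg_natr => // k _ _.
  by apply: integral_ge0 => w _; exact: rho0.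
by rewrite ge0_integral_bigcup.
Qed.

HB.instance Definition _ := isMeasure.Build _ _ _ Q
  density_measure0 density_measure_ge0 density_measure_sigma_additive.

Let density_measureT : Q [set: _] = 1%:E.
Proof. by rewrite /density_measure int_rho. Qed.

HB.instance Definition _ := @Measure_isProbability.Build _ _ R
  Q density_measureT.

Lemma density_measure_dominated : Q `<< P.
Proof.
apply/null_content_dominatesP => A mA PA0.
by rewrite /density_measure; apply: null_set_integral => //; exact: mE.
Qed.

Lemma density_measure_dominates : P `<< Q.
Proof.
apply/null_content_dominatesP => A mA; rewrite /density_measure => QA0.
have : (\int[P]_(w in A) `|(rho w)%:E| = 0)%E.
  by rewrite -[RHS]QA0; apply: eq_integral => w _; rewrite gee0_abs.
move/(ae_eq_integral_abs P mA (@mE A)) => [N [mN N0 AN]].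
apply: (subset_measure0 _ mN _ N0) => //; apply: subset_trans AN => w Aw /= /(_ Aw) [].
by apply/eqP; rewrite gt_eqF.
Qed.

(** The Radon-Nikodym derivative of the measure is almost everywhere the density
    it was built from. *)
Lemma integral_density_measure (h : T -> \bar R) : measurable_fun setT h ->
  (forall w, 0 <= h w)%E ->
  (\int[Q]_w h w = \int[P]_w (h w * (rho w)%:E))%E.
Proof.
move=> mh h0.
have QP := density_measure_dominated.
rewrite -(Radon_Nikodym_SigmaFinite.change_of_variables QP h0)//.
apply: ae_eq_integral => //.
- apply: emeasurable_funM => //.
  exact: measurable_int (Radon_Nikodym_SigmaFinite.f_integrable QP).
- by apply: emeasurable_funM => //; exact: mE.
apply: ae_eqe_mul2l; apply: integral_ae_eq => //.
- exact: Radon_Nikodym_SigmaFinite.f_integrable.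
- by move=> A _ mA; rewrite -Radon_Nikodym_SigmaFinite.f_integral.
Qed.

End density_measure.

Section equivalent_measure.
Context d (T : measurableType d) (R : realType) (P : probability T R).

Lemma equiv_prob_of_density (u : T -> R) : measurable_fun setT u ->
  (forall w, 0 < u w <= 1) ->
  exists Q : probability T R, equiv_prob P Q /\
  exists2 c : R, 0 < c & forall h : T -> \bar R, measurable_fun setT h ->
    (forall w, 0 <= h w)%E ->
    (\int[Q]_w h w = c%:E * \int[P]_w (h w * (u w)%:E))%E.
Proof.
move=> mu u01.
have u0 w : 0 < u w by have /andP[] := u01 w.
have bu : bounded_mfun u by apply: bounded_mfun01 => // w; have /andP[/ltW -> ->] := u01 w.
have Z0 : 0 < mean P u.
  rewrite lt_neqAle mean_ge0 ?andbT; last by move=> w; exact: ltW.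
  apply/negP => /eqP Z0; have := @mean_eq0 _ _ _ P _ bu (fun w => ltW (u0 w)).
  rewrite -Z0 lexx => /(_ isT) uz.
  have : mean P (fun=> 1 : R) = 0.
    rewrite -(mean_cst P 0); apply: ae_eq_mean; [exact: bounded_mfun_cst..|].
    by apply: filterS uz => w /eqP; rewrite gt_eqF.
  by rewrite mean_cst => /eqP; rewrite oner_eq0.
pose rho w := (mean P u)^-1 * u w.
have mrho : measurable_fun setT rho by exact: measurable_funM.
have rho0 w : 0 < rho w by rewrite mulr_gt0 ?invr_gt0.
have irho : (\int[P]_w (rho w)%:E = 1)%E.
  rewrite -EFin_mean; last exact: bounded_mfunZ.
  by rewrite meanZ// mulVf// gt_eqF.
exists (density_measure mrho rho0 irho); split.
  split; first exact: density_measure_dominated.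
  exact: density_measure_dominates.
exists (mean P u)^-1; first by rewrite invr_gt0.
move=> h mh h0; rewrite integral_density_measure//.
rewrite -ge0_integralZl_EFin//.
- by apply: eq_integral => w _; rewrite /rho EFinM muleCA.
- by move=> w _; rewrite mule_ge0// lee_fin ltW.
- by apply: emeasurable_funM => //; exact/measurable_EFinP.
- by rewrite invr_ge0 ltW.
Qed.

End equivalent_measure.

(** * Equivalence of the three conditions *)

Section equivalences.
Context d (T : measurableType d) (R : realType) (P : probability T R).
Context (f_ : nat -> Lplus P) (f : Lplus P).
Hypotheses (f0_ : forall m, L0plus (f_ m)) (f0 : L0plus f).

Local Notation F := (fun m => real_rep (f_ m)).
Local Notation F0 := (real_rep f).

Lemma expRN_lipschitz (x y : R) : 0 <= x -> 0 <= y ->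
  `|expR (- x) - expR (- y)| <= `|x - y|.
Proof.
wlog xy : x y / x <= y => [hw x0 y0|x0 y0].
  have [/hw|/ltW/hw] := leP x y; first exact.
  by rewrite (distrC x) (distrC (expR (- x))); exact.
have /andP[e0 e1] := expRN01 x0.
rewrite ger0_norm ?subr_ge0 ?ler_expR ?lerN2// ler0_norm ?subr_le0// opprB.
rewrite (_ : - y = - x + - (y - x)); last by ring.
rewrite expRD -[X in X - _]mulr1 -mulrBr.
apply: (le_trans (ler_piMl _ e1)); last exact: onem_expRN_le.
by have /andP[] : 0 <= 1 - expR (- (y - x)) <= 1 by apply: onem_expRN01; rewrite subr_ge0.
Qed.

Lemma integral_real_rep_dist (Q : probability T R) m : Q `<< P ->
  (\int[Q]_w `|f_ m w - f w| = \int[Q]_w `|F m w - F0 w|%:E)%E.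
Proof.
move=> QP; apply: ae_eq_integral => //.
- by apply: measurable_abse_sub; exact: Lplus_measurable.
- apply/measurable_EFinP; apply: measurableT_comp => //.
  by apply: measurable_funB; exact: (nonneg_mfun_real_rep _).1.
apply: (ae_dominates QP).
by apply: filterS2 (real_repE (f0_ m)) (real_repE f0) => w <- <- _; rewrite -EFinB.
Qed.

(** The [Q]-mean of [|h - f|] over a convex combination [h] of the tail is at most
    the supremum of those of [|f_ m - f|]; smallness in [Q]-mean then passes to
    the metric of [Lplus], defined by [P], by absolute continuity. *)
Lemma L1_forward_cvx_cvg : L1_cvg_equiv_prob f_ f -> forward_cvx_cvg f_ f.
Proof.
move=> [Q [QP PQ] [_ cQ]] h_ fh; split => //; first exact: forward_cvx_comb_L0 fh.
have /(forward_cvx_combP _ f0_)[N [a Na]] := fh.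
apply/Lplus_cvgP; apply/cvgrPdist_le => /= e e0.
have [delta delta0 Qe] := mean_abs_continuous PQ e0.
have [n _ nd] : \forall m \near \oo, (\int[Q]_w `|f_ m w - f w| <= delta%:E)%E.
  have /fine_cvgP[fi /cvgrPdist_le/(_ _ delta0)] := cQ; apply: filterS2 fi => m fi.
  rewrite sub0r normrN => le_d; rewrite -(fineK fi) lee_fin.
  by apply: le_trans le_d; exact: ler_norm.
exists n => // k /= nk; have [aw hE] := Na k; have [a0 az a1] := aw.
pose x w : R := `|expN (h_ k) w - expN f w|.
have bx : bounded_mfun x.
  by apply: bounded_mfun_norm; apply: bounded_mfunB; exact: bounded_mfun_expN.
have x01 w : 0 <= x w <= 1.
  rewrite normr_ge0/= /x ler_norml.
  have /andP[? ?] := expN01 (h_ k) w; have /andP[? ?] := expN01 f w.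
  by apply/andP; split; lra.
rewrite sub0r normrN ger0_norm; last by apply: mean_ge0 => w; have /andP[] := x01 w.
apply: Qe => //; first exact: bx.1.
rewrite -lee_fin EFin_mean//.
pose D m w : R := `|F m w - F0 w|.
have D0 m w : 0 <= D m w by exact: normr_ge0.
have mD m : measurable_fun setT (D m).
  apply: measurableT_comp => //.
  by apply: measurable_funB; exact: (nonneg_mfun_real_rep _).1.
apply: (@le_trans _ _ (\int[Q]_w (\sum_(m < N k) (a k m)%:E * (D m w)%:E)%E)%E).
  apply: ae_ge0_le_integral => //.
  - by apply/measurable_EFinP; exact: bx.1.
  - by move=> w _; apply: sume_ge0 => m _; rewrite mule_ge0 ?lee_fin.
  - apply: emeasurable_sum => m _; apply: emeasurable_funM => //.
    exact/measurable_EFinP.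
  apply: (ae_dominates QP).
  have hF := expN_real (nonneg_mfun_comb (N k) a0 (fun m => nonneg_mfun_real_rep (f_ m))).2 hE.
  apply: filterS2 hF (expN_real_rep f0) => w hF fF _; rewrite /x hF fF.
  rewrite (eq_bigr (fun m : 'I__ => (a k m * D m w)%:E)); last by move=> m _; rewrite EFinM.
  rewrite sumEFin lee_fin.
  apply: le_trans (expRN_lipschitz _ _) _.
  + exact: (nonneg_mfun_comb (N k) a0 (fun m => nonneg_mfun_real_rep (f_ m))).2.
  + exact: (nonneg_mfun_real_rep f).2.
  rewrite -[F0 in leLHS](comb_cst F0 aw) /comb -sumrB.
  apply: (le_trans (ler_norm_sum _ _ _)); apply: ler_sum => m _.
  by rewrite -mulrBr normrM ger0_norm.
rewrite ge0_integral_sum//; last 2 first.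
  - move=> m; apply: emeasurable_funM => //; exact/measurable_EFinP.
  - by move=> m w _; rewrite mule_ge0 ?lee_fin.
apply: (@le_trans _ _ (\sum_(m < N k) (a k m * delta)%:E)%E); last first.
  by rewrite sumEFin lee_fin -mulr_suml a1 mul1r.
apply: lee_sum => m _; rewrite ge0_integralZl_EFin//; last 2 first.
- by move=> w _; rewrite lee_fin.
- exact/measurable_EFinP.
have [km|mk] := leqP k m; last by rewrite az ?mul0e ?mul0r// negb_and -ltnNge mk.
rewrite EFinM lee_wpmul2l ?lee_fin//.
rewrite -(integral_real_rep_dist m QP); by apply: nd => /=; exact: leq_trans km.
Qed.

Lemma forward_cvx_cvg_unique_limit : forward_cvx_cvg f_ f ->
  forward_cvx_unique_limit f_ f.
Proof. by move=> S1 h_ g /S1[_ _ hf] hg; exact: Lplus_cvg_unique hg hf. Qed.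

Hypothesis deficit0 : gauge P (deficit f_ f m) @[m --> \oo] --> 0.

Lemma gaugeE (h : T -> R) : nonneg_mfun h ->
  gauge P h = 1 - mean P (fun w => expR (- h w)).
Proof.
move=> [mh h0]; rewrite /gauge meanB ?mean_cst//; first exact: bounded_mfun_cst.
exact: bounded_mfun_expRN.
Qed.

(** The constraint [E[exp (- h)] <= 1 - e] is preserved by midpoints and by
    limits, so a sequence of almost minimizers yields a limit [g] with
    [exp (- g) = exp (- f) u] and [E[u] <= 1 - e]; uniqueness of the limit would
    force [u = 1]. *)
Lemma unique_limit_vanishing_excess : forward_cvx_unique_limit f_ f ->
  vanishing_hulls P (excess f_ f).
Proof.
move=> S2 e e0; apply: contrapT => /forallNP nv.
pose D k := [set h | hull (excess f_ f) k h /\ mean P (fun w => expR (- h w)) <= 1 - e].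
have Dn k h : D k h -> nonneg_mfun h.
  by move=> [kh _]; apply: nonneg_mfun_hull kh; exact: nonneg_mfun_excess.
have [||||h_ [u [Dh mu u01 cu _]]] := @convergent_minimizers _ T R P D.
- by move=> k l kl h [lh he]; split => //; exact: le_hull lh.
- move=> k; have /existsNP[h /not_implyP[kh /negP]] := nv k.
  rewrite -ltNge gaugeE => [he|]; last first.
    by apply: nonneg_mfun_hull kh; exact: nonneg_mfun_excess.
  by exists h; split => //; lra.
- by move=> k h /Dn.
- move=> k g h Dg Dh; have [mg g0] := Dn _ _ Dg; have [mh h0] := Dn _ _ Dh.
  have [kg ge] := Dg; have [kh he] := Dh; split; first exact: hull_mid.
  have : 0 <= mean P (fun w => (expR (- (g w / 2)) - expR (- (h w / 2))) ^+ 2).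
    by apply: mean_ge0 => w; exact: sqr_ge0.
  rewrite (mean_sqr_expRN_half P mg mh g0 h0); move: ge he; clear.
  by move: (mean _ _) (mean _ _) (mean _ _) => A B C; lra.
have /choice[Na NaP] : forall k, exists Na : nat * (nat -> R),
    convex_weights k Na.1 Na.2 /\ h_ k = comb Na.1 Na.2 (excess f_ f).
  by move=> k; have [[N [a Na]] _] := Dh k; exists (N, a).
have aw k := (NaP k).1.
have /choice[hf_ hfE] : forall k, exists g : Lplus P,
    \forall w \ae P, g w = (comb (Na k).1 (Na k).2 F w)%:E.
  move=> k; apply: Lplus_of_real; have [a0 _ _] := aw k.
  by apply: nonneg_mfun_comb => // m; exact: nonneg_mfun_real_rep.
have fhf : forward_cvx_comb f_ hf_.
  by apply/forward_cvx_combP => //; exists (fun k => (Na k).1), (fun k => (Na k).2).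
have bu : bounded_mfun u by exact: bounded_mfun01.
have bf := bounded_mfun_expN f.
have bfu : bounded_mfun (fun w => expN f w * u w) by exact: bounded_mfunM.
have [g gE] : exists g : Lplus P, \forall w \ae P, expN g w = expN f w * u w.
  apply: Lplus_of_expN; first exact: bfu.1.
  move=> w; have /andP[? ?] := expN01 f w; have /andP[? ?] := u01 w.
  by rewrite mulr_ge0// mulr_ile1.
have bh k : bounded_mfun (fun w => expR (- h_ k w)).
  by have [? ?] := Dn _ _ (Dh k); exact: bounded_mfun_expRN.
have buh k : bounded_mfun (fun w => `|expR (- h_ k w) - u w|).
  by apply: bounded_mfun_norm; exact: bounded_mfunB.
have bdef k : bounded_mfun (fun w => 1 - expR (- comb (Na k).1 (Na k).2 (deficit f_ f) w)).
  have [a0 _ _] := aw k.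
  by apply: bounded_mfun_onem_expRN; apply: nonneg_mfun_comb => // m; exact: nonneg_mfun_deficit.
have cuh : mean P (fun w => `|expR (- h_ k w) - u w|) @[k --> \oo] --> 0.
  rewrite -[X in _ --> X](mean_cst P 0); apply: (@mean_cvg _ _ _ _ _ _ 1).
  - by move=> k; exact: (buh k).1.
  - move=> k w; rewrite normr_id; have /andP[? ?] := expRN01 ((Dn _ _ (Dh k)).2 w).
    by have /andP[? ?] := u01 w; rewrite ler_norml; apply/andP; split; lra.
  - exact: bounded_mfun_cst.
  apply: filterS cu => w cw; rewrite -(normr0 R) -(subrr (u w)).
  by apply: cvg_norm; apply: cvgB => //; exact: cvg_cst.
have hfg : hf_ @ \oo --> g.
  apply/Lplus_cvgP.
  have l0 : gauge P (comb (Na k).1 (Na k).2 (deficit f_ f)) +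
      mean P (fun w => `|expR (- h_ k w) - u w|) @[k --> \oo] --> 0.
    by rewrite -[X in _ --> X]addr0; exact: (cvgD (gauge_comb_deficit_cvg0 deficit0 aw) cuh).
  apply: (squeeze_cvgr _ (cvg_cst 0) l0); apply: nearW => k.
  rewrite mean_ge0//= /gauge -meanD//; apply: ae_mean_le.
  - by apply: bounded_mfun_norm; apply: bounded_mfunB; exact: bounded_mfun_expN.
  - exact: bounded_mfunD.
  have hk := expN_comb_excess f0 (aw k) (hfE k).
  apply: filterS2 hk gE => w; rewrite -(NaP k).2 => hk ->.
  have /andP[ef0 ef1] := expN01 f w.
  apply: (le_trans (ler_distD (expN f w * expR (- h_ k w)) _ _)); apply: lerD => //.
  by rewrite -mulrBr normrM ger0_norm// ler_piMl.
have gf := S2 _ _ fhf hfg; rewrite gf in gE.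
have u1 : \forall w \ae P, u w = 1.
  apply: filterS2 gE (expN_real_rep f0) => w + fF; rewrite fF => /esym/eqP.
  rewrite -subr_eq0 -{2}[expR _]mulr1 -mulrBr.
  by rewrite mulf_eq0 gt_eqF ?expR_gt0//= subr_eq0 => /eqP.
have eu : mean P u = 1.
  by rewrite -[RHS](mean_cst P 1); apply: ae_eq_mean => //; exact: bounded_mfun_cst.
have : mean P (fun w => expR (- h_ k w)) @[k --> \oo] --> mean P u.
  apply: (@mean_cvg _ _ _ _ _ _ 1) => //.
  - by move=> k; exact: (bh k).1.
  - move=> k w; rewrite ger0_norm ?expR_ge0//.
    by have /andP[] := expRN01 ((Dn _ _ (Dh k)).2 w).
move=> /cvgr_to_le => /(_ (1 - e)); rewrite eu => h.
have : 1 <= 1 - e by apply: h; apply: nearW => k; have [] := Dh k.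
lra.
Qed.

(** The density is proportional to [exp (- f) u], where [u] makes [|f_ m - f|] small
    in mean and [exp (- f)] makes [f] integrable. *)
Lemma vanishing_excess_L1 : vanishing_hulls P (excess f_ f) ->
  L1_cvg_equiv_prob f_ f.
Proof.
move=> vE.
have nE := nonneg_mfun_excess f_ f; have nD := nonneg_mfun_deficit f_ f.
have := vanishing_hullsD nE nD vE (vanishing_deficit deficit0).
move=> /vanishing_hulls_density[|u [mu u01 uG2 uG0]].
  by move=> m; exact: nonneg_mfunD.
have nF := nonneg_mfun_real_rep f.
pose v w := expR (- F0 w) * u w.
have mv : measurable_fun setT v by apply: measurable_funM => //; exact: measurable_expRN nF.1.
have v01 w : 0 < v w <= 1.
  have /andP[? ?] := u01 w; have /andP[? ?] := expRN01 (nF.2 w).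
  by rewrite /v mulr_gt0 ?expR_gt0//= mulr_ile1// ltW.
have [Q [PQ [c c0 Qint]]] := equiv_prob_of_density P mv v01.
have [QP _] := PQ.
exists Q => //.
have mD m : measurable_fun setT (fun w => `|F m w - F0 w|%:E).
  apply/measurable_EFinP; apply: measurableT_comp => //.
  by apply: measurable_funB; exact: (nonneg_mfun_real_rep _).1.
have intD m : (\int[Q]_w `|f_ m w - f w| <=
    c%:E * \int[P]_w (u w * (excess f_ f m w + deficit f_ f m w))%:E)%E.
  rewrite integral_real_rep_dist// Qint//.
  rewrite lee_pmul2l//; apply: ge0_le_integral => //.
  - move=> w _; rewrite mule_ge0 ?lee_fin//; have /andP[] := v01 w.
    by move=> ? _; exact: ltW.
  - by apply: emeasurable_funM => //; exact/measurable_EFinP.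
  - apply/measurable_EFinP; apply: measurable_funM => //.
    by apply: measurable_funD; [exact: (nE m).1|exact: (nD m).1].
  move=> w _; rewrite excess_deficit_norm -EFinM lee_fin mulrC ler_wpM2r//.
  have /andP[? _] := u01 w; have /andP[? ?] := expRN01 (nF.2 w).
  by rewrite /v ler_piMl// ltW.
split; last first.
  have cl : (c%:E * \int[P]_w (u w * (excess f_ f m w + deficit f_ f m w))%:E
      @[m --> \oo] --> 0)%E.
    by rewrite -(mule0 c%:E); exact: cvgeZl.
  apply: (squeeze_cvge _ (cvg_cst 0%E) cl).
  by apply: nearW => m; rewrite intD andbT; apply: integral_ge0.
have intF0 : (\int[Q]_w (F0 w)%:E <= c%:E)%E.
  rewrite Qint//; last 2 first.
  - exact/measurable_EFinP/nF.1.
  - by move=> w; rewrite lee_fin nF.2.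
  rewrite -[leRHS]mule1 lee_pmul2l//.
  rewrite -[leRHS](_ : (\int[P]_w (cst 1 w))%E = 1%E); last first.
    by rewrite integral_cst// [X in (_ * X)%E](@probability_setT _ _ _ P) mule1.
  apply: ge0_le_integral => //.
  - by move=> w _; rewrite -EFinM lee_fin mulr_ge0 ?nF.2//; have /andP[? _] := v01 w; exact: ltW.
  - by apply: emeasurable_funM; apply/measurable_EFinP => //; exact: nF.1.
  move=> w _; rewrite -EFinM lee_fin /v mulrA mulr_ile1//.
  + by rewrite mulr_ge0 ?nF.2 ?expR_ge0.
  + by have /andP[? _] := u01 w; exact: ltW.
  + by rewrite (le_trans (mul_expRN_le _))// lerBlDr lerDl expR_ge0.
  + by have /andP[] := u01 w.
apply: (@le_lt_trans _ _ (c%:E + c%:E * 2%:E)%E); last by rewrite -EFinM -EFinD ltry.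
apply: ge_ereal_sup => _ [m _ <-].
rewrite (_ : (\int[Q]_w f_ m w)%E = (\int[Q]_w (F m w)%:E)%E); last first.
  apply: ae_eq_integral => //.
    by apply/measurable_EFinP; exact: (nonneg_mfun_real_rep _).1.
  by apply: (ae_dominates QP); have := real_repE (f0_ m); apply: filterS => w -> _.
apply: (@le_trans _ _ (\int[Q]_w ((F0 w)%:E + `|F m w - F0 w|%:E))%E).
  apply: ge0_le_integral => //.
  - by move=> w _; rewrite lee_fin (nonneg_mfun_real_rep _).2.
  - by apply/measurable_EFinP; exact: (nonneg_mfun_real_rep _).1.
  - by apply: emeasurable_funD => //; apply/measurable_EFinP; exact: nF.1.
  by move=> w _; rewrite -EFinD lee_fin -lerBlDl ler_norm.
rewrite ge0_integralD//; last 2 first.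
- by move=> w _; rewrite lee_fin nF.2.
- by apply/measurable_EFinP; exact: nF.1.
apply: leeD => //.
rewrite -integral_real_rep_dist//; apply: (le_trans (intD m)).
by rewrite lee_pmul2l.
Qed.

End equivalences.

(** * Compactness of the simplex *)

Section compact_image.
Context (X Y : topologicalType) (i : X -> Y) (C : set X).
Hypotheses (hY : hausdorff_space Y) (ci : continuous i) (inji : injective i).
Hypothesis cC : compact C.

(** The images of the closed subsets of [C] are compact, hence closed. *)
Lemma compact_injection_traces U :
  (exists2 V : set Y, open V & U = (i @` C) `&` V) <->
  (exists2 W : set X, open W & U = (i @` C) `&` (i @` W)).
Proof.
split=> [[V oV ->]|[W oW ->]].
  exists (i @^-1` V); first exact: open_comp.
  apply/seteqP; split => [_ [[x Cx <-] Vx]|_ [[x Cx <-] [z Vz /= zx]]].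
    by split; [exists x|exists x].
  by split; [exists x|rewrite -zx].
have cCW : compact (i @` (C `&` ~` W)).
  apply: continuous_compact; last by apply: compact_closedI => //; exact: open_closedC.
  exact: continuous_subspaceT.
exists (~` (i @` (C `&` ~` W))).
  by apply: closed_openC; exact: compact_closed.
apply/seteqP; split => [_ [[x Cx <-] [z Wz /inji zx]]|_ [[x Cx <-] nW]].
  split; first by exists x.
  by move=> [y [_ nWy] /inji yx]; apply: nWy; rewrite yx -zx.
split; first by exists x.
by exists x => //; apply: contrapT => nWx; apply: nW; exists x.
Qed.

End compact_image.

Section simplex.
Context (R : realType).
Implicit Types (a b : nat -> R).

Lemma nneseries_le_bound (x : nat -> \bar R) (B : \bar R) :
  (forall n, (0 <= x n)%E) -> (forall k, (\sum_(n < k) x n <= B)%E) ->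
  (\sum_(n <oo) x n <= B)%E.
Proof.
move=> x0 xB; apply: lime_le; first by apply: is_cvg_nneseries.
by apply: nearW => k; rewrite /= big_mkord.
Qed.

Lemma nneseries_ge_partial (x : nat -> \bar R) k : (forall n, (0 <= x n)%E) ->
  (\sum_(n < k) x n <= \sum_(n <oo) x n)%E.
Proof. by move=> x0; rewrite -(big_mkord xpredT x); apply: nneseries_lim_ge. Qed.

Lemma nneseries_finite_support (x : nat -> \bar R) N : (forall n, (0 <= x n)%E) ->
  (forall n, (N <= n)%N -> x n = 0%E) ->
  (\sum_(n <oo) x n = \sum_(n < N) x n)%E.
Proof.
move=> x0 xN; apply/eqP; rewrite eq_le nneseries_ge_partial// andbT.
apply: nneseries_le_bound => // k.
have [kN|Nk] := leqP k N.
  rewrite -!(big_mkord xpredT x) (big_cat_nat (leq0n k) kN)/= leeDl//.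
  exact: sume_ge0.
rewrite -!(big_mkord xpredT x) (big_cat_nat (leq0n N) (ltnW Nk))/=.
rewrite [X in (_ + X)%E]big1_seq ?adde0// => m.
by rewrite mem_index_iota => /andP[_ /andP[/xN]].
Qed.

Lemma simplexP a : simplex a <->
  (forall n, 0 <= a n) /\ forall k, \sum_(n < k) a n <= 1.
Proof.
split=> -[a0 a1]; split => //.
  move=> k; rewrite -lee_fin -sumEFin; apply: le_trans a1.
  by apply: nneseries_ge_partial => n; rewrite lee_fin.
apply: nneseries_le_bound => [n|k]; first by rewrite lee_fin.
by rewrite sumEFin lee_fin.
Qed.

Lemma eval_continuous k : continuous (fun a : {ptws nat -> R} => a k : R).
Proof. exact: (@proj_continuous nat (fun=> R) k). Qed.

(** A closed subset of a product of unit intervals. *)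
Lemma compact_simplex : compact (@simplex R : set {ptws nat -> R}).
Proof.
have cI : compact [set a : {ptws nat -> R} | forall n, `[0, 1]%classic (a n)].
  by apply: (@tychonoff nat (fun=> R) (fun=> `[0, 1]%classic)) => n; exact: segment_compact.
have psum_cont k : continuous (fun a : {ptws nat -> R} => \sum_(n < k) a n).
  elim: k => [|k ih].
    rewrite (_ : (fun _ => _) = fun=> 0); first exact: cst_continuous.
    by apply/funext => a; rewrite big_ord0.
  rewrite (_ : (fun _ => _) = fun a : {ptws nat -> R} => \sum_(n < k) a n + a k).
    by move=> a; exact: (cvgD (ih a) (@eval_continuous k a)).
  by apply/funext => a; rewrite big_ord_recr.
apply: subclosed_compact cI _; last first.
  move=> a /simplexP[a0 a1] n /=; rewrite in_itv/= a0/=.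
  apply: le_trans (a1 n.+1); rewrite big_ord_recr/= lerDr sumr_ge0//.
rewrite (_ : @simplex R = \bigcap_(n in [set: nat])
    ((fun a : {ptws nat -> R} => a n) @^-1` [set x | 0 <= x] `&`
     (fun a : {ptws nat -> R} => \sum_(i < n) a i) @^-1` [set x | x <= 1])).
  apply: closed_bigI => n _; apply: closedI.
    apply: (@closed_comp _ _ (fun a : {ptws nat -> R} => a n)); last exact: closed_ge.
    by move=> a _; exact: (@eval_continuous n a).
  apply: (@closed_comp _ _ (fun a : {ptws nat -> R} => \sum_(i < n) a i)); last exact: closed_le.
  by move=> a _; exact: psum_cont.
apply/seteqP; split => a.
  by move=> /simplexP[a0 a1] n _; split; [exact: a0|exact: a1].
by move=> aI; apply/simplexP; split => n; have [] := aI n I.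
Qed.

Lemma simplex_near (a : {ptws nat -> R}) N (c : nat -> R) (e : R) : 0 < e ->
  nbhs a [set b : {ptws nat -> R} | \sum_(n < N) `|a n - b n| * c n < e].
Proof.
move=> e0; pose G k (b : {ptws nat -> R}) := \sum_(n < k) `|a n - b n| * c n.
have cG k : G k @ nbhs a --> (0 : R).
  elim: k => [|k ih].
    rewrite (_ : G 0%N = fun=> 0); first exact: cvg_cst.
    by apply/funext => b; rewrite /G big_ord0.
  have ck : (fun b : {ptws nat -> R} => `|a k - b k| * c k) @ nbhs a --> (0 : R).
    rewrite -(mul0r (c k)); apply: cvgMl; rewrite -(normr0 R) -(subrr (a k)).
    have cak : (fun b : {ptws nat -> R} => a k - b k) @ nbhs a --> a k - a k.
      exact: (cvgB (cvg_cst (a k)) (@eval_continuous k a)).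
    exact: (cvg_norm cak).
  rewrite (_ : G k.+1 = fun b => G k b + `|a k - b k| * c k).
    by rewrite -[X in _ --> X]addr0; exact: (cvgD ih ck).
  by apply/funext => b; rewrite /G big_ord_recr.
exact: (cvgr_lt 0 (cG N) _ e0).
Qed.

Lemma simplex_mix a b (t : R) : 0 <= t <= 1 -> simplex a -> simplex b ->
  simplex (fun n => t * a n + (1 - t) * b n).
Proof.
move=> /andP[t0 t1] /simplexP[a0 a1] /simplexP[b0 b1]; apply/simplexP; split.
  by move=> n; rewrite addr_ge0 ?mulr_ge0 ?subr_ge0.
move=> k; rewrite big_split/= -!mulr_sumr.
have : t * \sum_(n < k) a n <= t * 1 by rewrite ler_wpM2l.
have : (1 - t) * \sum_(n < k) b n <= (1 - t) * 1 by rewrite ler_wpM2l ?subr_ge0.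
lra.
Qed.

Lemma convex_weights_simplex n N a : convex_weights n N a ->
  simplex a /\ (\sum_(m <oo) (a m)%:E = 1)%E.
Proof.
move=> aw; have [a0 az a1] := aw.
have s1 : (\sum_(m <oo) (a m)%:E = 1)%E.
  rewrite (nneseries_finite_support (N := N)).
  - by rewrite sumEFin a1.
  - by move=> m; rewrite lee_fin.
  - by move=> m Nm; rewrite (convex_weights_out aw Nm).
by split => //; split => //; rewrite s1.
Qed.

(** Moving the missing mass and the tail of a point of the simplex to the
    single index [N] turns it into finite convex weights. *)
Lemma simplex_truncation a N : simplex a -> exists b,
  convex_weights 0 N.+1 b /\ forall n, (n < N)%N -> b n = a n.
Proof.
move=> /simplexP[a0 a1].
exists (fun n => if (n < N)%N then a n else (n == N)%:R * (1 - \sum_(m < N) a m)).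
split; last by move=> n ->.
split.
- by move=> n; case: ifP => // _; rewrite mulr_ge0// subr_ge0.
- move=> n; rewrite /= ltnS -ltnNge => Nn.
  by rewrite ltnNge (ltnW Nn)/= gtn_eqF// mul0r.
- rewrite big_ord_recr/= ltnn eqxx mul1r.
  under eq_bigr do rewrite ltn_ord; ring.
Qed.

End simplex.

(** * Inclusion of the integrable classes *)

Section L1_inclusion.
Context d (T : measurableType d) (R : realType) (P Q : probability T R).
Context (PQ : equiv_prob P Q).
Implicit Types g h : L1plus PQ.

Lemma L1plus_real g : \forall w \ae P, g w = (real_rep g w)%:E.
Proof.
have [QP PdQ] := PQ.
have ig : Q.-integrable setT g.
  apply/integrableP; split; first exact: Lplus_measurable.
  rewrite (ae_eq_integral (fun w => g w))//; first exact: (L1plus_fin g).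
  - by apply: measurableT_comp => //; exact: Lplus_measurable.
  - by apply: (ae_dominates QP); have := Lplus_ge0 g; apply: filterS => w g0 _; rewrite gee0_abs.
have gfin : L0plus g.
  apply: (ae_dominates PdQ); have := integrable_ae measurableT ig.
  by apply: filterS => w /(_ I); rewrite fin_numElt => /andP[].
by have := real_repE gfin; apply: filterS => w ->.
Qed.

Lemma L1plus_real_integrable g : Q.-integrable setT (EFin \o real_rep g).
Proof.
have [QP _] := PQ.
apply/integrableP; split; first exact/measurable_EFinP/(nonneg_mfun_real_rep _).1.
rewrite (ae_eq_integral (fun w => g w))//; first exact: (L1plus_fin g).
- apply: measurableT_comp => //; apply/measurable_EFinP.
  exact: (nonneg_mfun_real_rep _).1.
- apply: (ae_dominates QP); have := L1plus_real g; apply: filterS => w -> _.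
  by rewrite gee0_abs// lee_fin (nonneg_mfun_real_rep _).2.
Qed.

Lemma L1plus_distE g h :
  ((mdist g h)%:E = \int[Q]_w `|real_rep g w - real_rep h w|%:E)%E.
Proof.
have [QP _] := PQ.
have -> : mdist g h = fine (\int[Q]_w `|real_rep g w - real_rep h w|%:E)%E.
  transitivity (L1plus_dist g h); first by [].
  congr fine; apply: ae_eq_integral => //.
  - by apply: measurable_abse_sub; exact: Lplus_measurable.
  - apply/measurable_EFinP; apply: measurableT_comp => //.
    by apply: measurable_funB; exact: (nonneg_mfun_real_rep _).1.
  apply: (ae_dominates QP).
  by apply: filterS2 (L1plus_real g) (L1plus_real h) => w -> -> _; rewrite -EFinB.
rewrite fineK// ge0_fin_numE; last by apply: integral_ge0 => w _; rewrite lee_fin.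
have /integrableP[_] := integrableB measurableT (L1plus_real_integrable g)
  (L1plus_real_integrable h).
by [].
Qed.

Lemma L1plus_val_inj : injective (@L1plus_val _ _ _ _ _ PQ).
Proof.
move=> [g g1] [h h1] /= gh; subst h.
by congr Build_L1plus; exact: Prop_irrelevance.
Qed.

(** As [x |-> exp (- x)] is 1-Lipschitz on the nonnegative numbers, the [L1(Q)]
    distance bounds the [Q]-mean of [|exp (- g) - exp (- h)|], and [P] is absolutely
    continuous with respect to [Q]. *)
Lemma L1plus_val_continuous : continuous (@L1plus_val _ _ _ _ _ PQ).
Proof.
have [QP PdQ] := PQ.
move=> g V /nbhs_ballP[e /= e0 eV].
have e20 : 0 < e / 2 by rewrite divr_gt0.
have [delta delta0 Qe] := mean_abs_continuous PdQ e20.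
apply/nbhs_ballP; exists delta => //= h.
rewrite ballEmdist/= => gh; apply: eV; rewrite ballEmdist/= Lplus_distE.
set x : T -> R := fun w => `|expN g w - expN h w|.
have bx : bounded_mfun x.
  by apply: bounded_mfun_norm; apply: bounded_mfunB; exact: bounded_mfun_expN.
have x01 w : 0 <= x w <= 1.
  rewrite normr_ge0/= /x ler_norml.
  have /andP[? ?] := expN01 g w; have /andP[? ?] := expN01 h w.
  by apply/andP; split; lra.
apply: (@le_lt_trans _ _ (e / 2)); last by lra.
apply: Qe => //; first exact: bx.1.
rewrite -lee_fin EFin_mean//; apply: (@le_trans _ _ (mdist g h)%:E); last first.
  by rewrite lee_fin ltW.
rewrite L1plus_distE; apply: ae_ge0_le_integral => //.
- by move=> w _; rewrite lee_fin; have /andP[] := x01 w.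
- by apply/measurable_EFinP; exact: bx.1.
- apply/measurable_EFinP; apply: measurableT_comp => //.
  by apply: measurable_funB; exact: (nonneg_mfun_real_rep _).1.
apply: (ae_dominates QP).
have gE := expN_real (nonneg_mfun_real_rep g).2 (L1plus_real g).
have hE := expN_real (nonneg_mfun_real_rep h).2 (L1plus_real h).
apply: filterS2 gE hE => w gE hE _; rewrite lee_fin /x gE hE.
by apply: expRN_lipschitz; exact: (nonneg_mfun_real_rep _).2.
Qed.

Lemma L1plus_ball_cvx g r (h1 h2 h : L1plus PQ) (t : R) : 0 <= t <= 1 ->
  (\forall w \ae P, h w = t%:E * h1 w + (1 - t)%:E * h2 w)%E ->
  ball g r h1 -> ball g r h2 -> ball g r h.
Proof.
have [QP _] := PQ.
rewrite !ballEmdist/= => t01 hE r1 r2.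
have /andP[t0 t1] := t01.
suff : mdist g h <= t * mdist g h1 + (1 - t) * mdist g h2.
  move=> h0; apply: (le_lt_trans h0).
  have [t1'|t1'] := ltP 0 t.
    have : t * mdist g h1 < t * r by rewrite ltr_pM2l.
    have : (1 - t) * mdist g h2 <= (1 - t) * r by rewrite ler_wpM2l ?subr_ge0// ltW.
    lra.
  have -> : t = 0 by apply/eqP; rewrite eq_le t1' t0.
  by rewrite mul0r add0r subr0 mul1r.
rewrite -lee_fin EFinD !EFinM !L1plus_distE.
have md k : measurable_fun setT (fun w => `|real_rep g w - real_rep (k : L1plus PQ) w|%:E).
  apply/measurable_EFinP; apply: measurableT_comp => //.
  by apply: measurable_funB; exact: (nonneg_mfun_real_rep _).1.
rewrite -!ge0_integralZl_EFin// ?subr_ge0//.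
rewrite -ge0_integralD//; last 4 first.
- by move=> w _; rewrite mule_ge0// lee_fin ?subr_ge0.
- exact: emeasurable_funM.
- by move=> w _; rewrite mule_ge0// lee_fin ?subr_ge0.
- exact: emeasurable_funM.
apply: ae_ge0_le_integral => //.
- by move=> w _; rewrite adde_ge0// mule_ge0// lee_fin ?subr_ge0.
- by apply: emeasurable_funD; exact: emeasurable_funM.
apply: (ae_dominates QP).
have h12 : \forall w \ae P, h1 w = (real_rep h1 w)%:E /\ h2 w = (real_rep h2 w)%:E.
  by apply: filterS2 (L1plus_real h1) (L1plus_real h2) => w ? ?; split.
apply: filterS3 hE h12 (L1plus_real h) => w hE [h1E h2E] hR _.
move: hE; rewrite hR h1E h2E -!EFinM -!EFinD => -[->].
rewrite lee_fin; set G := real_rep g w; set x1 := real_rep h1 w; set x2 := real_rep h2 w.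
rewrite (_ : G - _ = t * (G - x1) + (1 - t) * (G - x2)); last by ring.
apply: (le_trans (ler_normD _ _)); rewrite !normrM (ger0_norm t0).
by rewrite [X in X * `|G - x2|]ger0_norm ?subr_ge0.
Qed.

End L1_inclusion.

(** * The closed convex hull as an image of the simplex *)

Section simplex_map.
Context d (T : measurableType d) (R : realType) (P Q : probability T R).
Context (PQ : equiv_prob P Q) (f_ : nat -> Lplus P) (f : Lplus P).
Hypotheses (f0_ : forall m, L0plus (f_ m)) (f0 : L0plus f).
Hypothesis cQ : L1_bounded_cvg Q f_ f.
Implicit Types a b : nat -> R.

Local Notation F := (fun m => real_rep (f_ m)).
Local Notation F0 := (real_rep f).

Let F_ge0 m w : 0 <= F m w. Proof. exact: (nonneg_mfun_real_rep _).2. Qed.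
Let F0_ge0 w : 0 <= F0 w. Proof. exact: (nonneg_mfun_real_rep _).2. Qed.
Let mF m : measurable_fun setT (fun w => (F m w)%:E).
Proof. exact/measurable_EFinP/(nonneg_mfun_real_rep _).1. Qed.
Let mF0 : measurable_fun setT (fun w => (F0 w)%:E).
Proof. exact/measurable_EFinP/(nonneg_mfun_real_rep _).1. Qed.
Let mD m : measurable_fun setT (fun w => `|F m w - F0 w|%:E).
Proof.
apply/measurable_EFinP; apply: measurableT_comp => //.
by apply: measurable_funB; exact: (nonneg_mfun_real_rep _).1.
Qed.

Definition mass a : \bar R := (\sum_(n <oo) (a n)%:E)%E.

Definition simplex_fun a (w : T) : \bar R :=
  (\sum_(n <oo) (a n)%:E * (F n w)%:E + (1 - mass a) * (F0 w)%:E)%E.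

Lemma integral_F_bounded : exists M : R, forall m,
  (\int[Q]_w (F m w)%:E <= M%:E)%E.
Proof.
have [QP _] := PQ; have [sup_fin _] := cQ.
have ub m : (\int[Q]_w (F m w)%:E <= ereal_sup (range (fun n => \int[Q]_w f_ n w)))%E.
  apply: ereal_sup_ubound; exists m => //=.
  apply: ae_eq_integral => //.
  by apply: (ae_dominates QP); have := real_repE (f0_ m); apply: filterS => w ->.
exists (fine (ereal_sup (range (fun n => (\int[Q]_w f_ n w)%E)))) => m.
rewrite fineK// ge0_fin_numE//; apply: le_trans (ub 0%N).
by apply: integral_ge0 => w _; rewrite lee_fin.
Qed.

Lemma integral_dist_cvg0 :
  (\int[Q]_w `|F m w - F0 w|%:E @[m --> \oo] --> 0)%E.
Proof.
have [QP _] := PQ; have [_] := cQ.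
by under eq_fun do rewrite (integral_real_rep_dist f0_ f0 _ QP).
Qed.

(** [f] is integrable as it is at finite distance from the integrable [f_ m], for
    some large [m]. *)
Lemma integral_F0_fin : (\int[Q]_w (F0 w)%:E < +oo)%E.
Proof.
have [M FM] := integral_F_bounded.
have [m mfin] : exists m, (\int[Q]_w `|F m w - F0 w|%:E)%E \is a fin_num.
  by have /fine_cvgP[[m _ /(_ m (leqnn m))]] := integral_dist_cvg0; exists m.
apply: (@le_lt_trans _ _ (\int[Q]_w ((F m w)%:E + `|F m w - F0 w|%:E))%E).
  apply: ge0_le_integral => //.
  - by move=> w _; rewrite lee_fin.
  - exact: emeasurable_funD.
  - by move=> w _; rewrite -EFinD lee_fin -lerBlDl distrC ler_norm.
rewrite ge0_integralD//; last by move=> w _; rewrite lee_fin.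
apply: lte_add_pinfty; last by rewrite -ge0_fin_numE// integral_ge0.
by apply: (le_lt_trans (FM m)); rewrite ltry.
Qed.

Lemma dist_coef : exists e_ : nat -> R,
  [/\ forall m, (\int[Q]_w `|F m w - F0 w|%:E = (e_ m)%:E)%E,
      forall m, 0 <= e_ m & e_ @ \oo --> 0].
Proof.
have [M FM] := integral_F_bounded.
have Dfin m : (\int[Q]_w `|F m w - F0 w|%:E)%E \is a fin_num.
  rewrite ge0_fin_numE; last by apply: integral_ge0 => w _; rewrite lee_fin.
  apply: (@le_lt_trans _ _ (\int[Q]_w ((F m w)%:E + (F0 w)%:E))%E).
    apply: ge0_le_integral => //.
    - exact: emeasurable_funD.
    - move=> w _; rewrite -EFinD lee_fin; apply: (le_trans (ler_normB _ _)).
      by rewrite !ger0_norm.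
  rewrite ge0_integralD//; [|by move=> w _; rewrite lee_fin..].
  apply: lte_add_pinfty; last exact: integral_F0_fin.
  by apply: (le_lt_trans (FM m)); rewrite ltry.
exists (fun m => fine (\int[Q]_w `|F m w - F0 w|%:E)%E); split.
- by move=> m; rewrite fineK.
- by move=> m; apply: fine_ge0; apply: integral_ge0 => w _; rewrite lee_fin.
- by have /fine_cvgP[] := integral_dist_cvg0.
Qed.

Lemma mass_fin a : simplex a -> exists s : R, mass a = s%:E /\ 0 <= s <= 1.
Proof.
move=> [a0 a1]; have m0 : (0 <= mass a)%E by apply: nneseries_ge0 => n _ _; rewrite lee_fin.
have mf : mass a \is a fin_num by rewrite ge0_fin_numE// (le_lt_trans a1)// ltry.
by exists (fine (mass a)); rewrite fineK// -!lee_fin fineK// m0.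
Qed.

Let aF_ge0 a n w : simplex a -> (0 <= (a n)%:E * (F n w)%:E)%E.
Proof. by move=> [a0 _]; rewrite mule_ge0 ?lee_fin. Qed.

Lemma simplex_fun_ge0 a w : simplex a -> (0 <= simplex_fun a w)%E.
Proof.
move=> sa; have [s [sE /andP[s0 s1]]] := mass_fin sa; rewrite /simplex_fun sE.
apply: adde_ge0; first by apply: nneseries_ge0 => n _ _; exact: aF_ge0.
by rewrite -EFinB mule_ge0 ?lee_fin ?subr_ge0.
Qed.

Let measurable_aF a : simplex a ->
  measurable_fun setT (fun w => \sum_(n <oo) (a n)%:E * (F n w)%:E)%E.
Proof.
move=> sa; apply: ge0_emeasurable_sum; first by move=> n w _ _; exact: aF_ge0.
by move=> n _; exact: emeasurable_funM.
Qed.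

Lemma measurable_simplex_fun a : simplex a -> measurable_fun setT (simplex_fun a).
Proof. by move=> sa; apply: emeasurable_funD; [exact: measurable_aF|exact: emeasurable_funM]. Qed.

Lemma integral_simplex_fun a : simplex a -> (\int[Q]_w simplex_fun a w < +oo)%E.
Proof.
move=> sa; have [M FM] := integral_F_bounded; have [a0 a1] := sa.
have [s [sE /andP[s0 s1]]] := mass_fin sa.
rewrite /simplex_fun sE -EFinB ge0_integralD//; last 4 first.
- by move=> w _; apply: nneseries_ge0 => n _ _; exact: aF_ge0.
- exact: measurable_aF.
- by move=> w _; rewrite mule_ge0 ?lee_fin ?subr_ge0.
- exact: emeasurable_funM.
have M0 : 0 <= M.
  by rewrite -lee_fin (le_trans _ (FM 0%N))// integral_ge0// => w _; rewrite lee_fin.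
apply: lte_add_pinfty; last first.
  rewrite ge0_integralZl_EFin ?subr_ge0//; last by move=> w _; rewrite lee_fin.
  by apply: lte_mul_pinfty; rewrite ?lee_fin ?subr_ge0//; exact: integral_F0_fin.
rewrite integral_nneseries//; last 2 first.
- by move=> n; exact: emeasurable_funM.
- by move=> n w _; exact: aF_ge0.
apply: (@le_lt_trans _ _ (\sum_(n <oo) M%:E * (a n)%:E)%E).
  apply: lee_nneseries => [n _ _|n _].
    by apply: integral_ge0 => w _; exact: aF_ge0.
  rewrite ge0_integralZl_EFin//; last by move=> w _; rewrite lee_fin.
  by rewrite muleC lee_wpmul2r ?lee_fin.
rewrite nneseriesZl; last by move=> n _; rewrite lee_fin.
by rewrite -/(mass a) sE -EFinM ltry.
Qed.

Lemma simplex_map_exists : exists Phi : (nat -> R) -> L1plus PQ,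
  forall a, simplex a -> \forall w \ae P, Phi a w = simplex_fun a w.
Proof.
have ex_a a : simplex a -> exists g : L1plus PQ, \forall w \ae P, g w = simplex_fun a w.
  move=> sa.
  have [g gE] := Lplus_exists P (measurable_simplex_fun sa) (fun w => simplex_fun_ge0 w sa).
  have g1 : (\int[Q]_w g w < +oo)%E.
    rewrite (ae_eq_integral (simplex_fun a))//; first exact: integral_simplex_fun.
    - exact: measurable_simplex_fun.
    - by have [QP _] := PQ; apply: (ae_dominates QP); exact: gE.
  by exists (Build_L1plus PQ g1); apply: filterS gE => w /(_ I).
have s0 : simplex (fun=> 0 : R).
  by split => //; rewrite eseries0.
have /choice[Phi PhiP] : forall a, exists g : L1plus PQ,
    simplex a -> \forall w \ae P, g w = simplex_fun a w.
  move=> a; have [/ex_a[g ga]|na] := pselect (simplex a); first by exists g.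
  by have [g _] := ex_a _ s0; exists g => /na.
by exists Phi.
Qed.

(** Pairing [(a n - b n)] with [(F n - F0)]: the total coefficient of the
    combination is one, so only the distances to [F0] matter.  The form without
    subtraction stays valid where the sums are infinite. *)
Lemma simplex_fun_le a b w : simplex a -> simplex b ->
  (simplex_fun a w <= simplex_fun b w +
     \sum_(n <oo) (`|a n - b n| * `|F n w - F0 w|)%:E)%E.
Proof.
move=> sa sb; have [a0 _] := sa; have [b0 _] := sb.
have [s [sE /andP[s0 s1]]] := mass_fin sa.
have [t [tE /andP[t0 t1]]] := mass_fin sb.
rewrite /simplex_fun sE tE.
set A := (\sum_(n <oo) (a n)%:E * _)%E; set B := (\sum_(n <oo) (b n)%:E * _)%E.
set D := (\sum_(n <oo) _)%E.
have key : (A + (F0 w * t)%:E <= B + D + (F0 w * s)%:E)%E.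
  rewrite !EFinM -sE -tE /mass -!nneseriesZl; [|by move=> n _; rewrite lee_fin..].
  rewrite -!nneseriesD; try by
    move=> n _ _; rewrite ?mule_ge0 ?adde_ge0 ?mule_ge0 ?lee_fin// mulr_ge0.
  apply: lee_nneseries => [n _ _|n _].
    by rewrite adde_ge0// mule_ge0 ?lee_fin.
  rewrite -!EFinM -!EFinD lee_fin -subr_ge0.
  have := ler_norm ((a n - b n) * (F n w - F0 w)); rewrite normrM; lra.
have := leeD key (lexx ((F0 w * (1 - s - t))%:E)).
rewrite -!EFinB -!EFinM -!addeA -!EFinD.
rewrite (_ : F0 w * t + F0 w * (1 - s - t) = (1 - s) * F0 w); last by ring.
rewrite (_ : F0 w * s + F0 w * (1 - s - t) = (1 - t) * F0 w); last by ring.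
by rewrite [(D + _)%E]addeC.
Qed.

Section map.
Variable Phi : (nat -> R) -> L1plus PQ.
Hypothesis PhiE : forall a, simplex a -> \forall w \ae P, Phi a w = simplex_fun a w.

(** The tail of the series is controlled by the total masses, which are at most
    one each; only finitely many coordinates matter, up to [2 * eps]. *)
Lemma simplex_map_dist a b (e_ : nat -> R) N (eps : R) : simplex a -> simplex b ->
  (forall m, (\int[Q]_w `|F m w - F0 w|%:E = (e_ m)%:E)%E) ->
  (forall m, (N <= m)%N -> e_ m <= eps) -> 0 <= eps ->
  mdist (Phi a) (Phi b) <= \sum_(n < N) `|a n - b n| * e_ n + 2 * eps.
Proof.
move=> sa sb eE Ne eps0; have [QP _] := PQ.
have e0 m : 0 <= e_ m by rewrite -lee_fin -eE integral_ge0// => w _; rewrite lee_fin.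
have abD0 n w : (0 <= (`|a n - b n| * `|F n w - F0 w|)%:E)%E by rewrite lee_fin mulr_ge0.
rewrite -lee_fin L1plus_distE.
apply: (@le_trans _ _ (\int[Q]_w (\sum_(n <oo) (`|a n - b n| * `|F n w - F0 w|)%:E)%E)%E).
  apply: ae_ge0_le_integral => //.
  - apply/measurable_EFinP; apply: measurableT_comp => //.
    by apply: measurable_funB; exact: (nonneg_mfun_real_rep _).1.
  - by move=> w _; apply: nneseries_ge0.
  - apply: ge0_emeasurable_sum => // n _; under eq_fun do rewrite EFinM.
    exact: emeasurable_funM.
  apply: (ae_dominates QP).
  have E c : simplex c -> \forall w \ae P, (real_rep (Phi c) w)%:E = simplex_fun c w.
    by move=> sc; apply: filterS2 (PhiE sc) (L1plus_real (Phi c)) => w <- ->.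
  apply: filterS2 (E _ sa) (E _ sb) => w aE bE _.
  have h1 := simplex_fun_le w sa sb; have := simplex_fun_le w sb sa.
  under eq_eseriesr do rewrite distrC.
  move: h1; rewrite -aE -bE; set D := (\sum_(_ <oo) _)%E.
  case: D => [D| |]; rewrite ?leey// -!EFinD !lee_fin ?leeNy_eq// => h1 h2.
  by rewrite ler_norml; apply/andP; split; lra.
rewrite integral_nneseries//; last first.
  by move=> n; under eq_fun do rewrite EFinM; exact: emeasurable_funM.
have aw n : (\int[Q]_w (`|a n - b n| * `|F n w - F0 w|)%:E = (`|a n - b n| * e_ n)%:E)%E.
  under eq_integral do rewrite EFinM.
  by rewrite ge0_integralZl_EFin// eE.
have /simplexP[a0 a1] := sa; have /simplexP[b0 b1] := sb.
apply: nneseries_le_bound => [n|k]; first by rewrite aw lee_fin mulr_ge0.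
under eq_bigr do rewrite aw; rewrite sumEFin lee_fin.
pose c n := if (n < N)%N then `|a n - b n| * e_ n else 0.
have c0 n : 0 <= c n by rewrite /c; case: ifP => // _; rewrite mulr_ge0.
apply: (@le_trans _ _ (\sum_(n < k) (c n + (a n * eps + b n * eps)))).
  apply: ler_sum => n _; rewrite /c; case: ltnP => [_|Nn].
    by rewrite lerDl addr_ge0// mulr_ge0.
  rewrite add0r -mulrDl; apply: ler_pM => //; last exact: Ne.
  by rewrite (le_trans (ler_normB _ _))// !ger0_norm.
rewrite !big_split/= -!mulr_suml; apply: lerD.
  have -> : \sum_(n < N) `|a n - b n| * e_ n = \sum_(n < N) c n.
    by apply: eq_bigr => n _; rewrite /c ltn_ord.
  rewrite -(sum_widen (x := c) (leq_maxl N k)).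
    by rewrite -!(big_mkord xpredT c) (big_cat_nat (leq0n k) (leq_maxr N k))/= lerDl sumr_ge0.
  by move=> n Nn; rewrite /c ltnNge Nn.
rewrite -mulrDl ler_wpM2r//; have := a1 k; have := b1 k; lra.
Qed.

Lemma simplex_map_compact : compact (Phi @` (@simplex R)).
Proof.
have [e_ [eE e0 ecvg]] := dist_coef.
apply: (@continuous_compact {ptws nat -> R} _ Phi); last exact: compact_simplex.
apply/subspace_continuousP => a sa V /nbhs_ballP[r /= r0 rV].
have r40 : 0 < r / 4 by rewrite divr_gt0.
have [N _ Ne] : \forall n \near \oo, e_ n < r / 4 by apply: (cvgr_lt 0).
have := simplex_near a N e_ r40; apply: filterS => b /= ab sb.
apply: rV; rewrite ballEmdist/=.
apply: le_lt_trans (simplex_map_dist sa sb eE (fun m Nm => ltW (Ne m Nm)) (ltW r40)) _.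
lra.
Qed.

Lemma simplex_combE : simplex_comb f_ f = L1plus_val (PQ := PQ) @` (Phi @` (@simplex R)).
Proof.
have fE : \forall w \ae P, (forall m, f_ m w = (F m w)%:E) /\ f w = (F0 w)%:E.
  by apply: filterS2 (ae_real_rep f0_) (real_repE f0) => w h1 h2; split.
have E (g : Lplus P) a : (g : T -> \bar R) = (fun w => (\sum_(n <oo) (a n)%:E * f_ n w)
      + (1 - \sum_(n <oo) (a n)%:E) * f w)%E %[ae P] <->
    \forall w \ae P, g w = simplex_fun a w.
  have E' w : (forall m, f_ m w = (F m w)%:E) /\ f w = (F0 w)%:E ->
      ((\sum_(n <oo) (a n)%:E * f_ n w) + (1 - \sum_(n <oo) (a n)%:E) * f w)%E =
      simplex_fun a w.
    by move=> [fm ->]; rewrite /simplex_fun; congr (_ + _)%E; apply: eq_eseriesr => n _; rewrite fm.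
  split=> h; apply: filterS2 fE h => w /E' e; first by move=> /(_ I) ->.
  by move=> -> _.
apply/seteqP; split => g.
  move=> [a sa /E gE]; exists (Phi a); first by exists a.
  apply: Lplus_eqP; apply: filterS2 gE (PhiE sa) => w -> ->; by [].
move=> [_ [a sa <-] <-]; exists a => //; apply/E; exact: PhiE.
Qed.

Lemma simplex_fun_mix a b t w : 0 <= t <= 1 -> simplex a -> simplex b ->
  simplex_fun (fun n => t * a n + (1 - t) * b n) w =
  (t%:E * simplex_fun a w + (1 - t)%:E * simplex_fun b w)%E.
Proof.
move=> t01 sa sb; have /andP[t0 t1] := t01; have [a0 _] := sa; have [b0 _] := sb.
have t1' : 0 <= 1 - t by rewrite subr_ge0.
have [s [sE /andP[s0 s1]]] := mass_fin sa.
have [s' [sE' /andP[s0' s1']]] := mass_fin sb.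
have massE : mass (fun n => t * a n + (1 - t) * b n) = (t * s + (1 - t) * s')%:E.
  rewrite EFinD !EFinM -sE -sE' /mass -!nneseriesZl; [|by move=> n _; rewrite lee_fin..].
  rewrite -nneseriesD; [|by move=> n _ _; rewrite mule_ge0 ?lee_fin..].
  by apply: eq_eseriesr => n _; rewrite EFinD !EFinM.
have sumE : (\sum_(n <oo) (t * a n + (1 - t) * b n)%:E * (F n w)%:E =
    t%:E * \sum_(n <oo) (a n)%:E * (F n w)%:E +
    (1 - t)%:E * \sum_(n <oo) (b n)%:E * (F n w)%:E)%E.
  rewrite -!nneseriesZl; [|by move=> n _; exact: aF_ge0..].
  rewrite -nneseriesD; [|by move=> n _ _; rewrite mule_ge0 ?aF_ge0 ?lee_fin..].
  by apply: eq_eseriesr => n _; rewrite -!EFinM -EFinD mulrDl !mulrA.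
rewrite /simplex_fun sumE massE sE sE' -!EFinB -!EFinM.
have S0 c : simplex c -> (0 <= \sum_(n <oo) (c n)%:E * (F n w)%:E)%E.
  by move=> sc; apply: nneseries_ge0 => n _ _; exact: aF_ge0.
rewrite ge0_muleDr ?S0 ?lee_fin ?mulr_ge0 ?subr_ge0//.
rewrite ge0_muleDr ?S0 ?lee_fin ?mulr_ge0 ?subr_ge0//.
rewrite addeACA -!EFinM -EFinD; congr (_ + _%:E)%E; ring.
Qed.

Lemma is_cvx_simplex_comb : is_cvx (simplex_comb f_ f).
Proof.
rewrite simplex_combE => _ _ h t [_ [a sa <-] <-] [_ [b sb <-] <-] t01 hE.
have sc := simplex_mix t01 sa sb.
exists (Phi (fun n => t * a n + (1 - t) * b n)); first by exists (fun n => t * a n + (1 - t) * b n).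
apply: Lplus_eqP.
have ab : \forall w \ae P, Phi a w = simplex_fun a w /\ Phi b w = simplex_fun b w.
  by apply: filterS2 (PhiE sa) (PhiE sb) => w ? ?; split.
apply: filterS3 hE (PhiE sc) ab => w + -> [aE bE] _ => ->//.
by rewrite simplex_fun_mix// aE bE.
Qed.

Lemma convex_weights_map n N a : convex_weights n N a ->
  \forall w \ae P, Phi a w = (comb N a F w)%:E.
Proof.
move=> aw; have [sa m1] := convex_weights_simplex aw.
apply: filterS (PhiE sa) => w ->; rewrite /simplex_fun /mass m1 subee// mul0e adde0.
rewrite (nneseries_finite_support (N := N)).
- by rewrite /comb -sumEFin; apply: eq_bigr => m _; rewrite EFinM.
- by move=> m; exact: aF_ge0.
- by move=> m Nm; rewrite (convex_weights_out aw Nm) mul0e.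
Qed.

Lemma range_forward : range f_ = [set f_ m | m in [set m | (0 <= m)%N]].
Proof. by apply/seteqP; split => _ [m _ <-]; exists m. Qed.

Lemma compact_simplex_comb : compact (simplex_comb f_ f).
Proof.
rewrite simplex_combE; apply: continuous_compact; last exact: simplex_map_compact.
by apply: continuous_subspaceT; exact: L1plus_val_continuous.
Qed.

(** The image of the simplex is compact, hence closed, and contains the convex
    combinations; conversely its points are approximated by those of their
    truncations. *)
Lemma closed_cvx_hullE : closed_cvx_hull (range f_) = simplex_comb f_ f.
Proof.
rewrite /closed_cvx_hull range_forward; apply/seteqP; split.
  have cl : closed (simplex_comb f_ f).
    by apply: compact_closed compact_simplex_comb; exact: metric_hausdorff.
  rewrite [X in _ `<=` X](closure_id _).1//; apply: closureS => h.
  move=> /(cvx_hullP _ _ f0_)[N [a [aw hE]]]; rewrite simplex_combE.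
  exists (Phi a); first by exists a => //; have [] := convex_weights_simplex aw.
  by apply: Lplus_eqP; apply: filterS2 hE (convex_weights_map aw) => w -> ->.
rewrite simplex_combE => _ [_ [a sa <-] <-] B.
move=> /(@L1plus_val_continuous _ _ _ _ _ PQ) /nbhs_ballP[r /= r0 rB].
have [e_ [eE e0 ecvg]] := dist_coef.
have r40 : 0 < r / 4 by rewrite divr_gt0.
have [N _ Ne] : \forall n \near \oo, e_ n < r / 4 by apply: (cvgr_lt 0).
have [b [bw ba]] := simplex_truncation N sa.
have [sb _] := convex_weights_simplex bw.
exists (L1plus_val (Phi b)); split.
  apply/cvx_hullP => //; exists N.+1, b; split => //; exact: convex_weights_map bw.
apply: rB; rewrite ballEmdist/=.
apply: le_lt_trans (simplex_map_dist sa sb eE (fun m Nm => ltW (Ne m Nm)) (ltW r40)) _.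
rewrite big1 ?add0r; first by lra.
by move=> n _; rewrite ba// subrr normr0 mul0r.
Qed.

Lemma simplex_comb_L1plus_compact : L1plus_compact PQ (simplex_comb f_ f).
Proof.
rewrite simplex_combE; split; first by move=> _ [g _ <-]; exists g.
rewrite (_ : _ @^-1` _ = Phi @` (@simplex R)); first exact: simplex_map_compact.
apply/seteqP; split => [g [h Ph /L1plus_val_inj <-]//|g Pg].
by exists g.
Qed.

Lemma simplex_comb_topologies : L0_L1_topologies_coincide PQ (simplex_comb f_ f).
Proof.
rewrite simplex_combE => U; apply: compact_injection_traces.
- exact: metric_hausdorff.
- exact: L1plus_val_continuous.
- exact: L1plus_val_inj.
- exact: simplex_map_compact.
Qed.

Lemma simplex_comb_L0 : simplex_comb f_ f `<=` @L0plus _ _ _ P.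
Proof.
rewrite simplex_combE => _ [g _ <-].
by have := L1plus_real g; apply: filterS => w ->; rewrite ltry.
Qed.

(** Traces of [L1plus] balls are convex, and they are neighbourhoods since the two
    topologies agree on the compact image. *)
Lemma is_locally_cvx_simplex_comb : is_locally_cvx (simplex_comb f_ f).
Proof.
split; first exact: is_cvx_simplex_comb.
move=> g Kg U.
have [g1 g1E] : exists g1 : L1plus PQ, L1plus_val g1 = g.
  by move: Kg; rewrite simplex_combE => -[g1 _ <-]; exists g1.
rewrite -g1E => /(@L1plus_val_continuous _ _ _ _ _ PQ) /nbhs_ballP[r /= r0 rU].
pose V := simplex_comb f_ f `&` (L1plus_val (PQ := PQ) @` ball g1 r).
exists V; split.
- by move=> h [].
- have [W opW VW] : exists2 W : set (Lplus P), open W & V = simplex_comb f_ f `&` W.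
    apply/simplex_comb_topologies; exists (ball g1 r)%R => //.
    rewrite openE => k; rewrite ballEmdist/= => gk.
    apply/nbhs_ballP; exists (r - mdist g1 k); first by rewrite /= subr_gt0.
    move=> l; rewrite !ballEmdist/= ltrBrDl; apply: le_lt_trans.
    exact: metric_triangle.
  have gV : V (L1plus_val g1).
    by split; [rewrite g1E|exists g1 => //; exact: ballxx].
  have : W (L1plus_val g1) by move: gV; rewrite VW => -[].
  move=> Wg; apply: filterS (open_nbhs_nbhs (conj opW Wg)) => h Wh Kh.
  by rewrite VW.
- move=> h1 h2 h t [Kh1 [k1 r1 k1E]] [Kh2 [k2 r2 k2E]] t01 hE.
  have Kh := is_cvx_simplex_comb Kh1 Kh2 t01 hE.
  split => //; have [k kE] : exists k : L1plus PQ, L1plus_val k = h.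
    by move: Kh; rewrite simplex_combE => -[k _ <-]; exists k.
  exists k => //; apply: (L1plus_ball_cvx t01 _ r1 r2).
  by rewrite kE k1E k2E; apply: filterS hE => w /(_ I).
- by move=> _ [_ [k /rU Uk <-]].
Qed.

End map.

End simplex_map.

(** * Vanishing of the deficit and synthesis *)

Section conclusion.
Context d (T : measurableType d) (R : realType) (P : probability T R).
Context (f_ : nat -> Lplus P) (f : Lplus P).
Hypotheses (f0_ : forall m, L0plus (f_ m)) (f0 : L0plus f).

Lemma L1_closed_hull_properties : L1_cvg_equiv_prob f_ f ->
  closed_hull_properties f_ f.
Proof.
move=> [Q PQ cQ]; have [Phi PhiE] := simplex_map_exists PQ f0_ f0 cQ.
rewrite /closed_hull_properties (closed_cvx_hullE f0_ f0 cQ PhiE); split => //.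
- move=> Q' PQ' cQ'; have [Phi' PhiE'] := simplex_map_exists PQ' f0_ f0 cQ'.
  split; first exact: (simplex_comb_L1plus_compact f0_ f0 cQ' PhiE').
  exact: (simplex_comb_topologies f0_ f0 cQ' PhiE').
- exact: (simplex_comb_L0 f0_ f0 PhiE).
- split; first exact: (is_locally_cvx_simplex_comb f0_ f0 cQ PhiE).
  exact: (compact_simplex_comb f0_ f0 cQ PhiE).
Qed.

(** On [f_ m < f], [exp (- f) (1 - exp (- (f - f_ m)))] is at most
    [exp (- f_ m) - exp (- f)]; the factor [exp (- f)] is then removed since [f] is
    finite. *)
Lemma deficit_cvg0_of_cvg : f_ @ \oo --> f ->
  gauge P (deficit f_ f m) @[m --> \oo] --> 0.
Proof.
move=> /Lplus_cvgP cf; apply/cvgrPdist_le => /= e e0.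
have e20 : 0 < e / 2 by rewrite divr_gt0.
have [mF F0] := nonneg_mfun_real_rep f.
have [M M0 tM] := mean_le_expRN_weight P mF F0 e20.
have eM : 0 < e / 2 / M by rewrite divr_gt0.
apply: filterS (cvgr_lt 0 cf _ eM) => m fm.
have nD := nonneg_mfun_deficit f_ f m.
have bD := bounded_mfun_onem_expRN nD.
rewrite sub0r normrN ger0_norm; last exact: gauge_ge0 nD.2.
apply: (le_trans (tM _ bD.1 (fun w => onem_expRN01 (nD.2 w)))).
rewrite [leRHS]splitr lerD2l -ler_pdivlMl// mulrC.
apply: le_trans (ltW fm); apply: ae_mean_le.
- by apply: bounded_mfunM => //; exact: bounded_mfun_expRN.
- by apply: bounded_mfun_norm; apply: bounded_mfunB; exact: bounded_mfun_expN.
apply: filterS2 (expN_real_rep (f0_ m)) (expN_real_rep f0) => w -> ->; rewrite /deficit.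
have [h|h] := leP (real_rep f w - real_rep (f_ m) w) 0.
  by rewrite oppr0 expR0 subrr mulr0.
set x := real_rep f w in h *; set y := real_rep (f_ m) w in h *.
apply: le_trans (ler_norm _).
have -> : expR (- y) - expR (- x) = expR (- y) * (1 - expR (- (x - y))).
  by rewrite mulrBr mulr1 -expRD; congr (_ - expR _); ring.
apply: ler_wpM2r; first by have /andP[] := onem_expRN01 (ltW h).
by rewrite ler_expR lerN2 -subr_ge0 ltW.
Qed.

Lemma deficit_cvg0_of_zero : (f : T -> \bar R) = cst 0%E %[ae P] ->
  gauge P (deficit f_ f m) @[m --> \oo] --> 0.
Proof.
move=> fz; rewrite (_ : (fun m => _) = fun=> 0); first exact: cvg_cst.
apply/funext => m; rewrite -(mean_cst P 0) /gauge; apply: ae_eq_mean.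
- by apply: bounded_mfun_onem_expRN; exact: nonneg_mfun_deficit.
- exact: bounded_mfun_cst.
apply: filterS2 fz (real_repE f0) => w /(_ I) -> [] Fz.
have := deficit_le f_ f m w; have := (nonneg_mfun_deficit f_ f m).2 w.
rewrite Fz => d0 d1; have -> : deficit f_ f m w = 0 by apply/eqP; rewrite eq_le d0 d1.
by rewrite oppr0 expR0 subrr.
Qed.

Lemma forward_cvx_equivalences : gauge P (deficit f_ f m) @[m --> \oo] --> 0 ->
  let S1 := forward_cvx_cvg f_ f in
  let S2 := forward_cvx_unique_limit f_ f in
  let S3 := L1_cvg_equiv_prob f_ f in
  let C := forward_cvx_limits f_ in
  [/\ (S1 <-> S2) /\ (S2 <-> S3),
      S1 \/ S2 \/ S3 -> closed_hull_properties f_ f &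
      ~ S1 \/ ~ S2 \/ ~ S3 -> ~ (C `<=` [set f]) /\ is_lower_bound f C].
Proof.
move=> def0 S1 S2 S3 C.
have S12 : S1 -> S2 by exact: forward_cvx_cvg_unique_limit.
have S23 : S2 -> S3.
  move=> /(unique_limit_vanishing_excess f0_ f0 def0).
  exact: vanishing_excess_L1.
have S31 : S3 -> S1 by exact: L1_forward_cvx_cvg.
split; first by tauto.
- by move=> S; apply: L1_closed_hull_properties; tauto.
move=> nS; split; last exact: forward_limit_ge.
have nS2 : ~ S2 by tauto.
by move=> Cf; apply: nS2 => h_ g fh hg; apply: Cf; exists h_.
Qed.

End conclusion.

Local Open Scope ereal_scope.

Theorem theorem1p3 (d : measure_display) (T : measurableType d) (R : realType)
    (P : probability T R) (f_ : nat -> Lplus P) (f : Lplus P)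
    (hf_ : forall n, L0plus (f_ n)) (hf : L0plus f) :
  let S1 := forward_cvx_cvg f_ f in
  let S2 := forward_cvx_unique_limit f_ f in
  let S3 := L1_cvg_equiv_prob f_ f in
  let C := forward_cvx_limits f_ in
  (cvg_L0 f_ f ->
     [/\ (S1 <-> S2) /\ (S2 <-> S3),
         S1 \/ S2 \/ S3 -> closed_hull_properties f_ f &
         ~ S1 \/ ~ S2 \/ ~ S3 -> [set f] `<` C /\ is_lower_bound f C]) /\
  ((f : T -> \bar R) = cst 0 %[ae P] ->
     [/\ (S1 <-> S2) /\ (S2 <-> S3),
         S1 \/ S2 \/ S3 -> closed_hull_properties f_ f &
         ~ S1 \/ ~ S2 \/ ~ S3 ->
           (* f need not belong to C here: take f_ constantly 1 and f = 0 *)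
           ~ (C `<=` [set f]) /\ is_lower_bound f C]).
Proof.
move=> S1 S2 S3 C; split.
  move=> [_ _ cf].
  have [S123 A1 A2] := forward_cvx_equivalences hf_ hf (deficit_cvg0_of_cvg hf_ hf cf).
  split => // /A2[nC lb]; split => //; split => //.
  by move=> _ ->; exists f_ => //; exact: forward_cvx_comb_self.
by move=> fz; exact: forward_cvx_equivalences hf_ hf (deficit_cvg0_of_zero f_ hf fz).
Qed.
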